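(* Let $d\ge1$, $a,r\in[0,1]$, and let $\omega,\phi_0:\mathbb{R}^d\to[0,\infty)$ belong to $L^1(\mathbb{R}^d)\cap L^\infty(\mathbb{R}^d)$, with $\int\phi_0\,dx=1$ and $\int\langle x\rangle^p(\omega+\phi_0)\,dx<\infty$ for some $p>1$. Let $(\phi_t)_{t\ge0}$ be the global Lagrangian distributional solution of $$\partial_t\phi_t=\operatorname{div}\bigl(\phi_t(K_a*\omega-K_r*\phi_t)\bigr)$$ with initial datum $\phi_0$. Assume additionally that $\phi_0$ is compactly supported and that $\int|x|^{1+a}\omega(x)\,dx<\infty$. If either $$a>r\ \text{ and }\ \omega(\mathbb{R}^d)>0,\qquad\text{or}\qquad a=r\ \text{ and }\ \omega(\mathbb{R}^d)>1,$$ then there exists $R_*<\infty$ such that $$\operatorname{supp}\phi_t\subset B_{R_*}(0)\qquad\text{for all }t\ge0.$$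
   Context: Notation: $\langle x\rangle=(1+|x|^2)^{1/2}$, $\omega(\mathbb{R}^d)=\int\omega\,dx$. For $s\in[0,1]$, $K_s(x)=\nabla|x|^{1+s}=(1+s)|x|^{s-1}x$ for $x\ne0$, $K_s(0)=0$. Lagrangian distributional solution (on every $[0,T]$): a nonnegative $\phi\in L^\infty(0,T;L^1\cap L^\infty)$ solving the equation in the sense of distributions with initial datum $\phi_0$, and such that $\phi_t=(X_t)_\#\phi_0$, where $\dot X_t(x)=-(K_a*\omega)(X_t(x))+(K_r*\phi_t)(X_t(x))$, $X_0(x)=x$, for $\phi_0$-a.e. $x$. Under the stated hypotheses on $\omega,\phi_0$ it exists for all times and is unique among such solutions whose $L^\infty$ norm and $p$-moment are bounded on each finite time interval. *)

(* Defs.v *)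
From HB Require Import structures.
From mathcomp Require Import all_boot all_order all_algebra.
From mathcomp Require Import all_classical all_reals all_analysis.

Set Implicit Arguments.
Unset Strict Implicit.
Unset Printing Implicit Defensive.

Import Order.TTheory GRing.Theory Num.Theory.
Import numFieldNormedType.Exports.

Local Open Scope classical_set_scope.
Local Open Scope ring_scope.

(* R^n is 'rV[R]_n. Its sigma-algebra is the one generated by the coordinates,
   i.e. the Borel one. The library norm `|x| on row vectors is the sup norm: it
   is only used through the topology, see enorm below for the Euclidean norm. *)

Definition rV_display : measure_display -> measure_display.
Proof. exact. Qed.

Section measurable_rV.
Context {R : realType}.

Section instance.
Variable n : nat.

Let coors : 'I_n -> 'rV[R]_n -> measurableTypeR R := fun i x => x ord0 i.

Let rV_set0 : g_sigma_preimage coors set0.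
Proof. exact: sigma_algebra0. Qed.

Let rV_setC A : g_sigma_preimage coors A -> g_sigma_preimage coors (~` A).
Proof. exact: sigma_algebraC. Qed.

Let rV_bigcup (F : _^nat) : (forall i, g_sigma_preimage coors (F i)) ->
  g_sigma_preimage coors (\bigcup_i (F i)).
Proof. exact: sigma_algebra_bigcup. Qed.

HB.instance Definition _ := @isMeasurable.Build
  (rV_display (R.-ocitv.-measurable.-sigma)%mdisp)
  'rV[R]_n (g_sigma_preimage coors) rV_set0 rV_setC rV_bigcup.

End instance.

Lemma measurable_coord n (i : 'I_n) :
  measurable_fun [set: 'rV[R]_n]
    (fun x : 'rV[R]_n => x ord0 i : measurableTypeR R).
Proof.
move=> _ A mA; rewrite setTI; apply: sub_sigma_algebra => /=.
rewrite -bigcup_seq/=; exists i => /=; first by rewrite mem_index_enum.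
by exists A => //; rewrite setTI.
Qed.

Lemma measurable_fun_rV d (T : measurableType d) n (f : T -> 'rV[R]_n) :
  (forall i, measurable_fun [set: T] (fun x => f x ord0 i : measurableTypeR R)) ->
  measurable_fun [set: T] f.
Proof.
move=> mf; apply: (@measurability _ _ _ _ _ _
  (\big[setU/set0]_(i < n) preimage_set_system setT
    (fun x : 'rV[R]_n => x ord0 i : measurableTypeR R) measurable)) => //.
move=> _ [B + <-]; rewrite -bigcup_seq/= => -[i _ [A mA <-]].
rewrite setTI; exact: mf.
Qed.

Definition rVcons n (z : measurableTypeR R * 'rV[R]_n) : 'rV[R]_n.+1 :=
  \row_i (if unlift ord0 i is Some j then z.2 ord0 j else z.1).

Definition rVuncons n (x : 'rV[R]_n.+1) : measurableTypeR R * 'rV[R]_n :=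
  (x ord0 ord0, \row_j x ord0 (lift ord0 j)).

Lemma rVconsK n : cancel (@rVcons n) (@rVuncons n).
Proof.
move=> [a v]; rewrite /rVcons /rVuncons; congr pair.
  by rewrite mxE unlift_none.
by apply/rowP => j; rewrite !mxE liftK.
Qed.

Lemma measurable_rVcons n : measurable_fun [set: _] (@rVcons n).
Proof.
apply: measurable_fun_rV => i.
case: (unliftP ord0 i) => [j ->|->].
  under eq_fun do rewrite mxE liftK.
  exact: (measurableT_comp (measurable_coord j) measurable_snd).
under eq_fun do rewrite mxE unlift_none.
exact: measurable_fst.
Qed.

Lemma measurable_rVuncons n : measurable_fun [set: _] (@rVuncons n).
Proof.
apply: measurable_fun_pair => /=; first exact: measurable_coord.
apply: measurable_fun_rV => i; under eq_fun do rewrite mxE.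
exact: measurable_coord.
Qed.

End measurable_rV.

Section lebesgue_measure_rV.
Context {R : realType}.

Section succ.
Variables (n : nat) (mu : {sigma_finite_measure set 'rV[R]_n -> \bar R}).

Definition lebesgue_succ : set 'rV[R]_n.+1 -> \bar R :=
  pushforward (@lebesgue_measure R \x mu)%E (@rVcons R n).

Let push : {measure set 'rV[R]_n.+1 -> \bar R} :=
  measure_function_pushforward__canonical__measure_function_Measure
    (@lebesgue_measure R \x mu)%E (@measurable_rVcons R n).

Let succ0 : lebesgue_succ set0 = 0%E.
Proof. exact: (measure0 push). Qed.

Let succ_ge0 A : (0 <= lebesgue_succ A)%E.
Proof. exact: (measure_ge0 push). Qed.

Let succ_sigma_additive : semi_sigma_additive lebesgue_succ.
Proof. exact: (@measure_semi_sigma_additive _ _ _ push). Qed.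

HB.instance Definition _ := isMeasure.Build _ _ _ lebesgue_succ
  succ0 succ_ge0 succ_sigma_additive.

Let succ_sigma_finite : sigma_finite setT lebesgue_succ.
Proof.
have /sigma_finiteP[F [TF ndF Foo]] := sigma_finiteT (@lebesgue_measure R).
have /sigma_finiteP[G [TG ndG Goo]] := sigma_finiteT mu.
exists (fun k => @rVuncons R n @^-1` (F k `*` G k)).
  apply/esym; rewrite -subTset => x _.
  have [i _ Fi] : (\bigcup_i F i) (rVuncons x).1 by rewrite -TF.
  have [j _ Gj] : (\bigcup_i G i) (rVuncons x).2 by rewrite -TG.
  exists (maxn i j) => //; split.
    by move: Fi; exact/subsetPset/ndF/leq_maxl.
  by move: Gj; exact/subsetPset/ndG/leq_maxr.
move=> k; have [mF Fk] := Foo k; have [mG Gk] := Goo k; split.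
  rewrite -[X in measurable X]setTI; apply: measurable_rVuncons => //.
  exact: measurableX.
rewrite /lebesgue_succ /pushforward.
rewrite (_ : _ @^-1` _ = F k `*` G k).
  by rewrite product_measure1E// lte_mul_pinfty// ge0_fin_numE.
by apply/funext => z; rewrite /preimage /mkset rVconsK.
Qed.

HB.instance Definition _ := @Measure_isSigmaFinite.Build _ _ _
  lebesgue_succ succ_sigma_finite.

End succ.

(* d-dimensional Lebesgue measure, as the iterated product of the
   one-dimensional one; on the one-point space R^0 it is the unit mass *)
Fixpoint lebesgue_rV (d : nat) : {sigma_finite_measure set 'rV[R]_d -> \bar R} :=
  match d with
  | 0 => @dirac _ 'rV[R]_0 0 R
  | d'.+1 => lebesgue_succ (lebesgue_rV d')
  end.

End lebesgue_measure_rV.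

Section euclidean.
Context {R : realType} {d : nat}.
Implicit Types (x : 'rV[R]_d) (f : 'rV[R]_d -> R).

Definition enorm x : R := Num.sqrt (\sum_i x ord0 i ^+ 2).

Definition eball (r : R) : set 'rV[R]_d := [set x | enorm x < r].

Definition japanese x : R := Num.sqrt (1 + enorm x ^+ 2).

(* the interaction kernel, i.e. the gradient of |x|^(1+s), and 0 at x = 0 *)
Definition kernel_K (s : R) x : 'rV[R]_d :=
  if x == 0 then 0 else ((1 + s) * enorm x `^ (s - 1)) *: x.

Definition convolution (K : 'rV[R]_d -> 'rV[R]_d) f x : 'rV[R]_d :=
  \row_i \int[lebesgue_rV d]_y (K (x - y) ord0 i * f y).

Definition density f (A : set 'rV[R]_d) : \bar R :=
  (\int[lebesgue_rV d]_(x in A) (f x)%:E)%E.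

(* The support of a class of functions modulo a.e. equality, equivalently of
   the measure f(x)dx: the complement of the largest open set on which f is
   a.e. zero *)
Definition ess_supp f : set 'rV[R]_d :=
  [set x | forall U, nbhs x U ->
     ~ {ae lebesgue_rV d, forall y, U y -> f y = 0}].

End euclidean.

Section test_functions.
Context {R : realType}.

Fixpoint Ck (V : normedModType R) (k : nat) (f : V -> R) : Prop :=
  match k with
  | 0 => continuous f
  | k'.+1 => (forall x, differentiable f x) /\ (forall v, Ck k' ('D_v f))
  end.

(* Elements of C_c^oo([0,T) x R^d), given as (restrictions to t >= 0 of)
   smooth functions on R x R^d with compact support in t < T *)
Definition test_function (d : nat) (T : R) (eta : R * 'rV[R]_d -> R) : Prop :=
  (forall k, Ck k eta) /\
  exists K, [/\ compact K, (forall z, K z -> z.1 < T)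
              & forall z, ~ K z -> eta z = 0].

Definition d_t (d : nat) (eta : R * 'rV[R]_d -> R) : R * 'rV[R]_d -> R :=
  'D_((1, 0) : R * 'rV[R]_d) eta.

Definition d_x (d : nat) (i : 'I_d) (eta : R * 'rV[R]_d -> R) :
    R * 'rV[R]_d -> R :=
  'D_((0, delta_mx ord0 i) : R * 'rV[R]_d) eta.

End test_functions.

Section solutions.
Context {R : realType} {d : nat}.
Variables (a r : R) (omega phi0 : 'rV[R]_d -> R).
Implicit Types (phi : R -> 'rV[R]_d -> R).

Local Notation mu := (lebesgue_rV d).

(* The equation reads d_t phi_t + div (phi_t v[phi_t]) = 0 *)
Definition velocity (phit : 'rV[R]_d -> R) (x : 'rV[R]_d) : 'rV[R]_d :=
  - convolution (kernel_K a) omega x + convolution (kernel_K r) phit x.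

Definition weak_solution (T : R) phi : Prop :=
  forall eta : R * 'rV[R]_d -> R, test_function T eta ->
    (\int[lebesgue_measure]_(t in `[0, T])
       (\int[mu]_x (phi t x * (d_t eta (t, x) +
          \sum_i (velocity (phi t) x ord0 i * d_x i eta (t, x)))))) +
    (\int[mu]_x (phi0 x * eta (0, x))) = 0.

Definition flow (T : R) phi (X : R -> 'rV[R]_d -> 'rV[R]_d) : Prop :=
  {ae density phi0, forall x,
    [/\ X 0 x = x,
        {within `[0, T], continuous (X ^~ x)}
      & forall t, t \in `]0, T[ ->
          is_derive t 1 (X ^~ x) (velocity (phi t) (X t x))]}.

Definition transported (T : R) phi (X : R -> 'rV[R]_d -> 'rV[R]_d) : Prop :=
  forall t, t \in `[0, T] ->
    measurable_fun [set: 'rV[R]_d] (X t) /\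
    forall A, measurable A ->
      density (phi t) A = pushforward (density phi0) (X t) A.

(* phi is a jointly Borel representative whose slice phi t is, at every time
   t, a density of phi_t *)
Definition lagrangian_solution (T : R) phi : Prop :=
  [/\ measurable_fun (`[0, T] `*` [set: 'rV[R]_d])
        (fun z : measurableTypeR R * 'rV[R]_d => phi z.1 z.2),
      (forall t x, t \in `[0, T] -> 0 <= phi t x),
      (exists C : R, {ae lebesgue_measure, forall t, t \in `[0, T] ->
        ('N[mu]_1[EFin \o phi t] <= C%:E)%E /\
        ('N[mu]_+oo[EFin \o phi t] <= C%:E)%E}),
      weak_solution T phi
    & exists X, flow T phi X /\ transported T phi X].

Definition locally_bounded (p T : R) phi : Prop :=
  exists C : R, forall t, t \in `[0, T] ->
    ('N[mu]_+oo[EFin \o phi t] <= C%:E)%E /\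
    (\int[mu]_x (japanese x `^ p * phi t x)%:E <= C%:E)%E.

(* Uniqueness of the global solution holds among the solutions with locally
   bounded L^oo norm and p-moment, hence the second condition *)
Definition global_solution (p : R) phi : Prop :=
  forall T, 0 < T -> lagrangian_solution T phi /\ locally_bounded p T phi.

End solutions.

(* Main.v *)
From HB Require Import structures.
From mathcomp Require Import all_boot all_order all_algebra.
From mathcomp Require Import all_classical all_reals all_analysis.
From mathcomp Require Import measurable_realfun ring lra.
Require Import Defs.

(* The second moment and the radius of the cloud of trajectories control each
   other.  Let [P = phi0 dx] and let [X_t] be the flow, so that [phi_t] is the
   law of [X_t] under [P], and let [W] be the mass of [omega].  Far from the
   origin the attraction gives [x . (K_a * omega)(x) >= (1+a) W |x|^(1+a) -
   O(|x|^a)], while [x . (K_r * phi_t)(x) <= (1+r) |x|^r (|x| + m)] where [m] is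
   the first moment of [phi_t].  On a finite time interval Gronwall's lemma
   bounds the trajectories; let [L] be the best bound.

   If [a > r], then [m <= L] is enough: for large [L] every trajectory moves
   inwards as long as [L/2 <= |x| <= L], so [L] was not optimal.

   If [a = r] and [W > 1], one needs [m = o(L)].  After symmetrization the
   repulsion contributes [(1+a)/2 E|X-Y|^(1+a)] to half the derivative of the
   second moment, with [X], [Y] independent of law [phi_t], and this is at most
   [(1+a) (E|X|^(1+a) + 4)].  Hence that derivative is at most
   [- c E|X|^(1+a) + C <= - (c / L) E|X|^2 + C], so the second moment is [O(L)],
   and [m <= e L + O(1/e)].

   The bound on [E|X-Y|^q], [1 <= q <= 2], follows from the pointwise inequality
   [|x-y|^q <= |x|^q + |y|^q - q x.y max(|x|,|y|)^(q-2)], whose last kernel is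
   positive definite: the power of the maximum is the minimum of a function of
   [x] and the same function of [y], thus a mixture of products of indicators (a
   finite mixture is used here, at the price of an additive constant). *)

Set Implicit Arguments.
Unset Strict Implicit.
Unset Printing Implicit Defensive.

Import Order.TTheory GRing.Theory Num.Theory.
Import numFieldNormedType.Exports.

Local Open Scope classical_set_scope.
Local Open Scope ring_scope.

(** * Euclidean vectors and the interaction kernel *)

Section dot_product.
Context {R : realType} {d : nat}.
Implicit Types x y z : 'rV[R]_d.

Definition dotv x y : R := \sum_i x ord0 i * y ord0 i.

Lemma dotvC x y : dotv x y = dotv y x.
Proof. by apply: eq_bigr => i _; rewrite mulrC. Qed.

Lemma dotvDr x y z : dotv x (y + z) = dotv x y + dotv x z.
Proof. by rewrite -big_split; apply: eq_bigr => i _; rewrite mxE mulrDr. Qed.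

Lemma dotvZr c x y : dotv x (c *: y) = c * dotv x y.
Proof. by rewrite /dotv big_distrr; apply: eq_bigr => i _; rewrite mxE mulrCA. Qed.

Lemma dotvNr x y : dotv x (- y) = - dotv x y.
Proof. by rewrite -scaleN1r dotvZr mulN1r. Qed.

Lemma dotv0 x : dotv x 0 = 0.
Proof. by rewrite -(scale0r x) dotvZr mul0r. Qed.

Lemma dot0v x : dotv 0 x = 0.
Proof. by rewrite dotvC dotv0. Qed.

Lemma enorm_ge0 x : 0 <= enorm x.
Proof. exact: sqrtr_ge0. Qed.

Lemma dotvv x : dotv x x = enorm x ^+ 2.
Proof.
rewrite sqr_sqrtr; last by apply: sumr_ge0 => i _; exact: sqr_ge0.
by apply: eq_bigr => i _; rewrite expr2.
Qed.

Lemma enorm0 : enorm (0 : 'rV[R]_d) = 0.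
Proof. by apply/eqP; rewrite -(sqrf_eq0) -dotvv dotv0. Qed.

Lemma enormN x : enorm (- x) = enorm x.
Proof.
by congr Num.sqrt; apply: eq_bigr => i _; rewrite mxE sqrrN.
Qed.

Lemma enorm_sqrD x y : enorm (x + y) ^+ 2 = enorm x ^+ 2 + enorm y ^+ 2 + 2 * dotv x y.
Proof.
rewrite -!dotvv dotvDr [dotv (x + y) x]dotvC [dotv (x + y) y]dotvC !dotvDr.
by rewrite (dotvC y x); ring.
Qed.

Lemma enorm_sqrB x y : enorm (x - y) ^+ 2 = enorm x ^+ 2 + enorm y ^+ 2 - 2 * dotv x y.
Proof. by rewrite enorm_sqrD enormN dotvNr; ring. Qed.

Lemma ler_coord_enorm x i : `|x ord0 i| <= enorm x.
Proof.
rewrite -(@ler_pXn2r _ 2) ?nnegrE ?enorm_ge0// real_normK ?num_real//.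
rewrite -dotvv /dotv (bigD1 i)//= -expr2 lerDl.
by apply: sumr_ge0 => j _; rewrite -expr2 sqr_ge0.
Qed.

Lemma enorm_gt0 x : (0 < enorm x) = (x != 0).
Proof.
apply/idP/idP => [|x0]; first by apply: contraTneq => ->; rewrite enorm0 ltxx.
rewrite lt_neqAle enorm_ge0 andbT eq_sym; apply: contra_neq x0 => x0.
apply/rowP => i; rewrite mxE; apply/eqP; rewrite -normr_le0 -x0.
exact: ler_coord_enorm.
Qed.

Lemma normr_dotv_le x y : `|dotv x y| <= enorm x * enorm y.
Proof.
have [->|y0] := eqVneq y 0; first by rewrite dotv0 enorm0 normr0 mulr0.
rewrite -(@ler_pXn2r _ 2) ?nnegrE ?mulr_ge0 ?enorm_ge0// real_normK ?num_real//.
have B0 : 0 < enorm y ^+ 2 by rewrite exprn_gt0// enorm_gt0.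
rewrite -(ler_pM2l B0) exprMn -subr_ge0.
have := sqr_ge0 (enorm (enorm y ^+ 2 *: x - dotv x y *: y)).
rewrite enorm_sqrB -!dotvv !dotvZr ![dotv (_ *: _) _]dotvC !dotvZr.
by rewrite (dotvC y x) !dotvv; nra.
Qed.

Lemma ler_enormD x y : enorm (x + y) <= enorm x + enorm y.
Proof.
rewrite -(@ler_pXn2r _ 2) ?nnegrE ?addr_ge0 ?enorm_ge0//.
by rewrite enorm_sqrD; have := le_trans (ler_norm _) (normr_dotv_le x y); nra.
Qed.

Lemma ler_enormB x y : enorm (x - y) <= enorm x + enorm y.
Proof. by rewrite (le_trans (ler_enormD _ _))// enormN. Qed.

End dot_product.

(** * Elementary inequalities for real powers *)

Section power_inequalities.
Context {R : realType}.
Implicit Types u w s : R.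

(** Splitting [z = z^s z^(1-s)] for both variables reduces the claim to the monotonicity of
    [z^(1-s)]. It moves an exponent from the larger quantity to the smaller one. *)
Lemma powR_exchange u w s : 0 <= u -> u <= w -> s <= 1 ->
  u * w `^ s <= u `^ s * w.
Proof.
move=> u0 uw s1; have [->|un0] := eqVneq u 0.
  by rewrite mul0r mulr_ge0// ?powR_ge0// (le_trans u0).
have up : 0 < u by rewrite lt_neqAle eq_sym un0.
have wp : 0 < w by exact: lt_le_trans uw.
have E z : 0 < z -> z = z `^ s * z `^ (1 - s).
  move=> z0; rewrite -powRD ?(gt_eqF z0) ?implybT// addrC subrK powRr1//.
  exact: ltW.
rewrite [in leLHS](E u)// [in leRHS](E w)// -!mulrA.
rewrite ler_wpM2l ?powR_ge0// mulrC ler_wpM2l ?powR_ge0//.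
by apply: ge0_ler_powR; rewrite ?subr_ge0// nnegrE ltW.
Qed.

(** The sum is at most twice the larger term, and [2^s <= 2]. *)
Lemma ler_powRD u w s : 0 <= u -> 0 <= w -> 0 <= s <= 1 ->
  (u + w) `^ s <= 2 * (u `^ s + w `^ s).
Proof.
wlog uw : u w / u <= w => [H u0 w0 s01|u0 w0 /andP[s0 s1]].
  have [uw|/ltW wu] := leP u w; first exact: H.
  by rewrite addrC [_ `^ s + _]addrC; exact: H.
apply: (@le_trans _ _ ((2 * w) `^ s)).
  by apply: ge0_ler_powR => //; rewrite ?nnegrE; lra.
rewrite powRM//; apply: (@le_trans _ _ (2 * w `^ s)).
  by rewrite ler_wpM2r ?powR_ge0// ler1_powR// ler1n.
by rewrite ler_wpM2l// lerDr powR_ge0.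
Qed.

(** For [0 < s < 1] this is Young's inequality for the product [u^s * 1] with exponents [1/s] and
    [1/(1-s)]. *)
Lemma bernoulli_powR u s : 0 <= u -> 0 <= s <= 1 -> u `^ s <= 1 + s * (u - 1).
Proof.
move=> u0 /andP[]; rewrite le_eqVlt => /predU1P[<- _|s0].
  by rewrite powRr0 mul0r addr0.
rewrite le_eqVlt => /predU1P[->|s1]; first by rewrite powRr1// mul1r subrKC.
have := @conjugate_powR _ (u `^ s) 1 s^-1 (1 - s)^-1 (powR_ge0 _ _) ler01.
rewrite !invr_gt0 subr_gt0 !invrK => /(_ s0 s1).
rewrite addrC subrK => /(_ erefl).
by rewrite -powRrM mulfV ?gt_eqF// powRr1// powR1; lra.
Qed.

Lemma ler_powR_affine u s : 0 <= u -> 0 <= s <= 1 -> u `^ s <= 1 + u.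
Proof.
move=> u0 s01; apply: (le_trans (bernoulli_powR u0 s01)).
by case/andP: s01; nra.
Qed.

Lemma powR1D u s : 0 <= u -> 0 <= s -> u `^ (1 + s) = u * u `^ s.
Proof.
move=> u0 s0; rewrite powRD ?powRr1//; apply/implyP.
by rewrite (gt_eqF (ltr_pwDl _ _)).
Qed.

End power_inequalities.

(** * Bounds on the kernel tested against the position *)

Section kernel.
Context {R : realType} {d : nat}.
Implicit Types (x y z : 'rV[R]_d) (s : R).

(** Euler's identity for the homogeneous function [|z|^(1+s)]; both sides vanish at [z = 0]. *)
Lemma dotv_kernel_sub x y s : 0 <= s ->
  dotv (x - y) (kernel_K s (x - y)) = (1 + s) * enorm (x - y) `^ (1 + s).
Proof.
move=> s0; rewrite /kernel_K; case: ifPn => [/eqP ->|z0].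
  by rewrite dotv0 enorm0 powR0 ?mulr0// gt_eqF// ltr_pwDl.
rewrite dotvZr dotvv -mulrA; congr (_ * _).
have /gt_eqF e0 : 0 < enorm (x - y) by rewrite enorm_gt0.
rewrite -powR_mulrn ?enorm_ge0// -powRD ?e0 ?implybT//; congr (_ `^ _); ring.
Qed.

Lemma normr_dotv_kernel x z s : 0 <= s ->
  `|dotv x (kernel_K s z)| <= (1 + s) * (enorm x * enorm z `^ s).
Proof.
move=> s0; rewrite /kernel_K; case: ifPn => [/eqP ->|z0].
  by rewrite dotv0 normr0 !mulr_ge0 ?enorm_ge0 ?powR_ge0// addr_ge0.
have /gt_eqF e0 : 0 < enorm z by rewrite enorm_gt0.
have c0 : 0 <= (1 + s) * enorm z `^ (s - 1) by rewrite mulr_ge0 ?powR_ge0 ?addr_ge0.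
rewrite dotvZr normrM ger0_norm//.
rewrite (le_trans (ler_wpM2l c0 (normr_dotv_le _ _)))//.
rewrite -[leLHS]mulrA ler_wpM2l ?addr_ge0// mulrCA ler_wpM2l ?enorm_ge0//.
by rewrite -{2}[enorm z]powRr1 ?enorm_ge0// -powRD ?e0 ?implybT// subrK.
Qed.

Lemma normr_kernel_coord z s i : 0 <= s <= 1 ->
  `|kernel_K s z ord0 i| <= 2 * (1 + enorm z).
Proof.
move=> /[dup] s01 /andP[s0 s1].
have -> : kernel_K s z ord0 i = dotv (delta_mx ord0 i) (kernel_K s z).
  rewrite /dotv (bigD1 i)//= big1 ?addr0; last first.
    by move=> j ji; rewrite mxE (negbTE ji) mul0r.
  by rewrite mxE !eqxx mul1r.
rewrite (le_trans (normr_dotv_kernel _ _ _))//.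
have -> : enorm (delta_mx ord0 i : 'rV[R]_d) = 1.
  rewrite /enorm (bigD1 i)//= big1 ?addr0; last first.
    by move=> j ji; rewrite mxE (negbTE ji) expr0n.
  by rewrite mxE !eqxx expr1n sqrtr1.
rewrite mul1r ler_pM ?powR_ge0 ?addr_ge0//; first by lra.
by rewrite ler_powR_affine// enorm_ge0.
Qed.

(** [powR_exchange] with [|x| <= |x| + |y|] puts the exponent [s] on [|x|] alone. The bound becomes
    affine in [|y|], so that integrating it in [y] involves only a first moment. *)
Lemma ler_dotv_kernel_rep x y s : 0 <= s <= 1 ->
  `|dotv x (kernel_K s (x - y))| <= (1 + s) * (enorm x `^ s * (enorm x + enorm y)).
Proof.
move=> /andP[s0 s1]; rewrite (le_trans (normr_dotv_kernel _ _ _))//.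
rewrite ler_wpM2l ?addr_ge0// (@le_trans _ _ (enorm x * (enorm x + enorm y) `^ s))//.
  rewrite ler_wpM2l ?enorm_ge0// ge0_ler_powR ?nnegrE ?addr_ge0 ?enorm_ge0//.
  exact: ler_enormB.
by rewrite powR_exchange ?enorm_ge0// lerDl enorm_ge0.
Qed.

(* [x . K(x - y) = (x - y) . K(x - y) + y . K(x - y)], and the first term is
   compared to [|x|^(1+s)] by [|z| (|z| + |y|)^s <= |z|^s (|z| + |y|)]. *)
Lemma ger_dotv_kernel_att x y s : 0 <= s <= 1 ->
  (1 + s) * (enorm x `^ (1 + s) - 5 * enorm y * enorm x `^ s
             - 4 * enorm y `^ (1 + s)) <= dotv x (kernel_K s (x - y)).
Proof.
move=> /[dup] s01 /andP[s0 s1]; set z := x - y.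
have -> : dotv x (kernel_K s z) = dotv z (kernel_K s z) + dotv y (kernel_K s z).
  rewrite [dotv z _]dotvC [dotv y _]dotvC -dotvDr [in LHS]dotvC.
  by rewrite /z subrK.
rewrite {1}/z dotv_kernel_sub// -/z.
have := normr_dotv_kernel y z s0; rewrite ler_norml => /andP[+ _].
set D := dotv y _; set X := enorm x; set Y := enorm y; set Z := enorm z => hD.
have [X0 Y0 Z0] : [/\ 0 <= X, 0 <= Y & 0 <= Z] by split; exact: enorm_ge0.
have XZ : X <= Z + Y by rewrite (le_trans _ (ler_enormD _ _))// /z subrK.
have ZX : Z <= X + Y by exact: ler_enormB.
suff : X `^ (1 + s) - 5 * Y * X `^ s - 4 * Y `^ (1 + s) <= Z `^ (1 + s) - Y * Z `^ s.
  by move: hD; nra.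
have h1 : X * X `^ s <= Z * X `^ s + Y * X `^ s.
  by rewrite -mulrDl ler_wpM2r ?powR_ge0.
have h2 : Z * X `^ s <= Z * (Z + Y) `^ s.
  by rewrite ler_wpM2l// ge0_ler_powR ?nnegrE ?addr_ge0.
have h3 : Z * (Z + Y) `^ s <= Z `^ s * (Z + Y) by rewrite powR_exchange// lerDl.
have h4 : Y * Z `^ s <= Y * (2 * (X `^ s + Y `^ s)).
  rewrite ler_wpM2l// (le_trans _ (ler_powRD _ _ _))// ge0_ler_powR ?nnegrE//.
  exact: addr_ge0.
by rewrite !powR1D//; lra.
Qed.

End kernel.

(** * Negative type of powers of the distance *)

Section layers.
Context {R : realType}.

Lemma sum_layers_full (n : nat) (c : R) : n%:R <= c ->
  \sum_(k < n) (k.+1%:R <= c)%R%:R = n%:R :> R.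
Proof.
elim: n => [|n IH] nc; first by rewrite big_ord0.
by rewrite big_ord_recr/= nc IH ?natr1// (le_trans _ nc)// ler_nat.
Qed.

(** The sum counts the positive integers not exceeding [c]: it is the integer part of [c]. *)
Lemma sum_layers_bounds (n : nat) (c : R) : 0 <= c <= n%:R ->
  c - 1 <= \sum_(k < n) (k.+1%:R <= c)%R%:R <= c.
Proof.
elim: n c => [|n IH] c /andP[c0 cn]; first by rewrite big_ord0; lra.
rewrite big_ord_recr/=; have [cn'|nc] := leP c n%:R.
  have -> : (n.+1%:R <= c) = false.
    by apply/negbTE; rewrite -ltNge (le_lt_trans cn')// ltr_nat.
  by rewrite addr0 IH// c0.
rewrite (sum_layers_full (ltW nc)); move: cn; rewrite -natr1.
by case: (leP (n%:R + 1) c) => h cn /=; lra.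
Qed.

End layers.

Section negative_type.
Context {R : realType} {d : nat}.
Implicit Types (x y : 'rV[R]_d) (s : R).

(** As [s - 1 <= 0], the power of the maximum of two norms is the minimum of two weights. Truncating
    the norm at 1 keeps the weights in [[0, 1]], so that finitely many layers of equal height
    approximate them. *)
Definition layer_weight s x : R := (Num.max 1 (enorm x)) `^ (s - 1).

Lemma layer_weight_bounds s x : s <= 1 -> 0 <= layer_weight s x <= 1.
Proof.
move=> s1; rewrite powR_ge0/= -[leRHS](powRr0 (Num.max 1 (enorm x))).
by rewrite ler_powR ?le_max ?lexx// subr_le0.
Qed.

Lemma layer_weight_min s x y : s <= 1 -> enorm y <= enorm x ->
  Num.min (layer_weight s x) (layer_weight s y) = layer_weight s x.
Proof.
move=> s1 yx; apply/min_idPl; rewrite /layer_weight -(opprB 1 s) !powRN.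
have p0 (z : 'rV[R]_d) : 0 < Num.max 1 (enorm z) by rewrite lt_max ltr01.
rewrite lef_pV2 ?posrE ?powR_gt0//.
apply: ge0_ler_powR; rewrite ?subr_ge0 ?nnegrE ?(ltW (p0 _))//.
by rewrite ge_max le_max lexx/= le_max yx orbT.
Qed.

(* Bernoulli's inequality at [w = |x - y|^2 / |x|^2], where [|y| <= |x|] *)
Lemma enormB_powR_le_min s x y : 0 <= s <= 1 ->
  enorm (x - y) `^ (1 + s) <= enorm x `^ (1 + s) + enorm y `^ (1 + s) + 6
   - (1 + s) * (dotv x y * Num.min (layer_weight s x) (layer_weight s y)).
Proof.
move=> /[dup] s01 /andP[s0 s1].
wlog yx : x y / enorm y <= enorm x => [H|].
  have [xy|/ltW yx] := leP (enorm x) (enorm y); last exact: H.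
  rewrite -opprB enormN dotvC minC [enorm x `^ _ + _]addrC; exact: H.
rewrite layer_weight_min//; move: yx; set M := enorm x; set m := enorm y => yx.
have [m0 Z0] : 0 <= m /\ 0 <= enorm (x - y) by split; exact: enorm_ge0.
have := normr_dotv_le x y; rewrite -/M -/m ler_norml => /andP[D1 D2].
have Mp := powR_ge0 M (1 + s); have mp := powR_ge0 m (1 + s).
(* When both norms are at most 1, the left side is at most [2^(1+s) <= 4] and the scalar product
   term at most 2: hence the constant 6. *)
have [M1|M1] := leP M 1.
  have -> : layer_weight s x = 1.
    by rewrite /layer_weight -/M; have /max_idPl -> := M1; rewrite powR1.
  have D1' : dotv x y <= 1.
    by rewrite (le_trans D2)// -[leRHS]mulr1 ler_pM ?enorm_ge0// (le_trans yx).
  suff : enorm (x - y) `^ (1 + s) <= 4.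
    have : (1 + s) * dotv x y <= 2 * 1 by nra.
    by rewrite mulr1; lra.
  apply: (@le_trans _ _ (2 `^ (1 + s))).
    rewrite ge0_ler_powR ?nnegrE ?addr_ge0//.
    by rewrite (le_trans (ler_enormB _ _))// -/M -/m;  lra.
  rewrite [leRHS](_ : 4 = 2 `^ 2); last by rewrite powR_mulrn//; ring.
  by rewrite ler_powR ?ler1n//; lra.
have M0 : 0 < M by exact: lt_trans M1.
have Mn0 : M != 0 by rewrite gt_eqF.
have -> : layer_weight s x = M `^ s / M.
  rewrite /layer_weight -/M; have /max_idPr -> := ltW M1.
  by rewrite powRB ?powRr1 ?Mn0 ?implybT// ltW.
(* The exponent [(1 + s) / 2] of the squared ratio lies in [[0, 1]], as Bernoulli's inequality
   requires. *)
have -> : enorm (x - y) `^ (1 + s) =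
    M `^ (1 + s) * ((enorm (x - y) / M) ^+ 2) `^ ((1 + s) / 2).
  rewrite -powR_mulrn ?divr_ge0 ?(ltW M0)// -powRrM.
  have -> : 2 * ((1 + s) / 2) = 1 + s by field.
  by rewrite -powRM ?divr_ge0 ?(ltW M0)// mulrCA mulfV// mulr1.
apply: (@le_trans _ _ (M `^ (1 + s) * (1 + (1 + s) / 2 * ((enorm (x - y) / M) ^+ 2 - 1)))).
  by rewrite ler_wpM2l// bernoulli_powR ?sqr_ge0//; lra.
rewrite expr_div_n enorm_sqrB -/M -/m !powR1D ?(ltW M0)//.
(* The remainder left by Bernoulli is [(1+s)/2 |y|^2 |x|^(s-1)]; it is at most [|y|^(1+s)] because
   [|y| <= |x|]. *)
have h : m * M `^ s <= m `^ s * M by rewrite powR_exchange.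
have h2 : m * (m * (M `^ s / M)) <= m * m `^ s.
  by rewrite ler_wpM2l// mulrA ler_pdivrMr.
have [Ms ms] : 0 <= M `^ s /\ 0 <= m `^ s by rewrite !powR_ge0.
have -> : M * M `^ s * (1 + (1 + s) / 2 * ((M ^+ 2 + m ^+ 2 - 2 * dotv x y) / M ^+ 2 - 1))
  = M * M `^ s + (1 + s) / 2 * (m * (m * (M `^ s / M))) - (1 + s) * (dotv x y * (M `^ s / M)).
  by field.
have := mulr_ge0 m0 ms.
set A := m * m `^ s in h2 *; set B := m * (m * _) in h2 *; clearbody A B => A0.
have h3 : (1 + s) / 2 * B <= (1 + s) / 2 * A by rewrite ler_wpM2l//; lra.
have h4 : (1 + s) / 2 * A <= 1 * A by rewrite ler_wpM2r//; lra.
by lra.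
Qed.

(* Up to an error at most 1, [n] times the minimum of two weights is the sum over
   [k < n] of the products of their layers. *)
Definition layer (n : nat) s (k : nat) x : R := (k.+1%:R <= n%:R * layer_weight s x)%R%:R.

(** The product of the [k]-th layers at [x] and [y] is the [k]-th layer of the minimum. Rounding [n]
    times the minimum to an integer changes the scalar product term by at most
    [|x.y| / n <= L^2 / n <= 1]; the factor [1 + s <= 2] turns the constant 6 into 8. *)
Lemma enormB_powR_le_layers n s (L : R) x y : (0 < n)%N -> L ^+ 2 <= n%:R ->
  0 <= s <= 1 -> enorm x <= L -> enorm y <= L ->
  enorm (x - y) `^ (1 + s) <= enorm x `^ (1 + s) + enorm y `^ (1 + s) + 8
   - (1 + s) / n%:R * \sum_(k < n) dotv (layer n s k x *: x) (layer n s k y *: y).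
Proof.
move=> n0 Ln /[dup] s01 /andP[s0 s1] xL yL.
have n0' : 0 < n%:R :> R by rewrite ltr0n.
apply: (le_trans (enormB_powR_le_min x y s01)).
set mu := Num.min _ _.
have mu01 : 0 <= mu <= 1.
  have /andP[a1 a2] := layer_weight_bounds x s1.
  have /andP[b1 b2] := layer_weight_bounds y s1.
  by rewrite /mu le_min a1 b1 ge_min a2.
have -> : \sum_(k < n) dotv (layer n s k x *: x) (layer n s k y *: y) =
          (\sum_(k < n) (k.+1%:R <= n%:R * mu)%R%:R) * dotv x y.
  rewrite big_distrl/=; apply: eq_bigr => k _.
  rewrite dotvZr dotvC dotvZr dotvC mulrA; congr (_ * _).
  rewrite /layer /mu minr_pMr ?ler0n// le_min.
  by case: (_ <= _); case: (_ <= _); rewrite ?mulr1 ?mul0r ?mulr0 ?mul1r.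
have nmu : 0 <= n%:R * mu <= n%:R.
  case/andP: mu01 => mu0 mu1; rewrite mulr_ge0 ?(ltW n0')//=.
  by rewrite -[leRHS]mulr1 ler_pM2l.
have /andP[] := sum_layers_bounds nmu.
set S := \sum_(_ < _) _ => S1 S2.
have D : `|dotv x y| <= n%:R.
  rewrite (le_trans (normr_dotv_le _ _))// (le_trans _ Ln)// expr2.
  by rewrite ler_pM ?enorm_ge0.
set D' := dotv x y in D *.
have E : `|D' * mu - S * D' / n%:R| <= 1.
  have -> : D' * mu - S * D' / n%:R = D' / n%:R * (n%:R * mu - S).
    by field; rewrite gt_eqF.
  rewrite normrM -[leRHS]mulr1 ler_pM//.
    by rewrite normrM normfV (gtr0_norm n0') ler_pdivrMr// mul1r.
  by rewrite ler_norml; lra.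
have -> : (1 + s) / n%:R * (S * D') = (1 + s) * (S * D' / n%:R) by ring.
move: E; rewrite ler_norml => /andP[]; set u := D' * mu; set v := S * D' / _.
by nra.
Qed.

End negative_type.

(** * Measures with a density *)

Section weighted_measure.
Local Open Scope ereal_scope.
Context {dT} {T : measurableType dT} {R : realType} (mu : {measure set T -> \bar R}).
Variable f : T -> R.

(** The measure [f dmu]. The proofs are arguments so that the measure structure declared below can
    be inferred from the term. *)
Definition weighted (mf : measurable_fun setT f) (f0 : forall x, (0 <= f x)%R)
  (A : set T) : \bar R := \int[mu]_(x in A) (f x)%:E.

Hypotheses (mf : measurable_fun setT f) (f0 : forall x, (0 <= f x)%R).

Let nu := weighted mf f0.

Let nu0 : nu set0 = 0. Proof. exact: integral_set0. Qed.

Let nu_ge0 A : 0 <= nu A.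
Proof. by apply: integral_ge0 => x _; rewrite lee_fin. Qed.

Let nu_sigma_additive : semi_sigma_additive nu.
Proof.
move=> F mF tF mUF; rewrite /nu /weighted ge0_integral_bigcup//.
- by apply: is_cvg_ereal_nneg_natsum => n _; exact: nu_ge0.
- exact/measurable_EFinP/measurable_funTS.
- by move=> x _; rewrite lee_fin.
Qed.

HB.instance Definition _ := isMeasure.Build _ _ _ (weighted mf f0)
  nu0 nu_ge0 nu_sigma_additive.

Import HBNNSimple.

(** True for indicators by definition of the measure, then for simple functions by linearity, and in
    general by monotone convergence on both sides. *)
Lemma ge0_integral_weighted (g : T -> \bar R) : measurable_fun setT g ->
  (forall x, 0 <= g x) ->
  \int[weighted mf f0]_x g x = \int[mu]_x (g x * (f x)%:E).
Proof.
move=> mg g0; pose g_ := nnsfun_approx measurableT mg.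
transitivity (limn (fun n => \int[weighted mf f0]_x (g_ n x)%:E)).
  rewrite -monotone_convergence//=.
  - apply: eq_integral => x _; apply/esym/cvg_lim => //=.
    by apply: cvg_nnsfun_approx.
  - by move=> n; apply: measurableT_comp => //; exact: measurable_funTS.
  - by move=> n x _; rewrite lee_fin.
  - by move=> x _ a b ab; rewrite lee_fin//; exact/lefP/nd_nnsfun_approx.
transitivity (limn (fun n => \int[mu]_x ((g_ n x)%:E * (f x)%:E))); last first.
  rewrite -monotone_convergence//=.
  - apply: eq_integral => x _; apply/cvg_lim => //=.
    apply: cvgeZr => //; by apply: cvg_nnsfun_approx.
  - by move=> n; apply: emeasurable_funM; apply/measurable_EFinP.
  - by move=> n x _; rewrite mule_ge0// lee_fin.
  - move=> x _ a b ab; rewrite lee_wpmul2r// lee_fin//.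
    exact/lefP/nd_nnsfun_approx.
congr (limn _); apply/funext => n.
transitivity (\sum_(k \in range (g_ n))
    \int[weighted mf f0]_x (k * \1_(g_ n @^-1` [set k]) x)%:E).
  under eq_integral do rewrite fimfunE -fsumEFin//.
  rewrite ge0_integral_fsum//.
  - by move=> y; exact/measurable_EFinP/measurable_funM.
  - by move=> y x _; rewrite nnfun_muleindic_ge0.
transitivity (\sum_(k \in range (g_ n))
    \int[mu]_x ((k * \1_(g_ n @^-1` [set k]) x)%:E * (f x)%:E)); last first.
  rewrite -ge0_integral_fsum//.
  - apply: eq_integral => x _; rewrite [in RHS]fimfunE -fsumEFin//.
    by rewrite ge0_mule_fsuml// => k; rewrite nnfun_muleindic_ge0.
  - move=> y; apply: emeasurable_funM; apply/measurable_EFinP => //.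
    exact: measurable_funM.
  - move=> y x _; apply: mule_ge0; last by rewrite lee_fin.
    by rewrite EFinM nnfun_muleindic_ge0.
apply: eq_fsbigr => k kr; rewrite integralZl_indic_nnsfun// integral_indic// setIT.
have k0 : (0 <= k)%R.
  by move: kr; rewrite inE => -[x _ <-].
under [RHS]eq_integral do rewrite EFinM -muleA.
rewrite ge0_integralZl//; last 2 first.
- by apply: emeasurable_funM; apply/measurable_EFinP.
- by move=> x _; rewrite mule_ge0// lee_fin.
congr (_ * _); transitivity (weighted mf f0 (g_ n @^-1` [set k])) => //.
rewrite /weighted integral_mkcond; apply: eq_integral => x _.
rewrite patchE indicE; case: ifPn => _; first by rewrite mul1e.
by rewrite mul0e.
Qed.

Lemma integral_weighted (g : T -> \bar R) : measurable_fun setT g ->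
  \int[weighted mf f0]_x g x = \int[mu]_x (g x * (f x)%:E).
Proof.
move=> mg; rewrite [LHS]integralE [RHS]integralE.
rewrite !ge0_integral_weighted//; [|exact: measurable_funeneg|exact: measurable_funepos].
congr (_ - _); apply: eq_integral => x _.
  by rewrite !funeposE maxeMl ?lee_fin// mul0e.
by rewrite !funenegE -mulNe maxeMl ?lee_fin// mul0e.
Qed.

Lemma Rintegral_weighted (g : T -> R) : measurable_fun setT g ->
  (\int[weighted mf f0]_x g x = \int[mu]_x (g x * f x))%R.
Proof.
by move=> mg; rewrite /Rintegral integral_weighted//; exact/measurable_EFinP.
Qed.

End weighted_measure.

(** * Differential inequalities and moments *)

Section barrier.
Context {R : realType}.
Implicit Types f df : R -> R.

(** If [f t > K], let [s] be the last time before [t] with [f <= K], which exists by continuity. On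
    []s, t]] one has [f > K], so the derivative is nonpositive there and the mean value theorem
    gives [f t <= f s <= K]. *)
Lemma barrier_le f df (T K : R) : {within `[0, T], continuous f} ->
  (forall t : R, t \in `]0, T[ -> is_derive t 1 f (df t)) ->
  f 0 <= K -> (forall t : R, t \in `]0, T[ -> K < f t -> df t <= 0) ->
  forall t : R, t \in `[0, T] -> f t <= K.
Proof.
move=> cf dff f0 df0 t; rewrite in_itv/= => /andP[t0 tT].
rewrite leNgt; apply/negP => Kft.
pose A := [set u : R | 0 <= u <= t /\ f u <= K].
have A0 : A 0 by rewrite /A/= lexx t0.
have ubA : ubound A t by move=> u [/andP[]].
have supA : has_sup A by split; [exists 0|exists t].
set s := sup A.
have s0 : 0 <= s by apply: sup_upper_bound.
have st : s <= t by apply: ge_sup => //; exists 0.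
have fs : f s <= K.
  rewrite leNgt; apply/negP => Kfs.
  have sT : `[0, T]%classic s by rewrite /= in_itv/= s0 (le_trans st).
  move/subspace_continuousP : (cf) => /(_ s sT) /cvgrPdist_lt /(_ (f s - K)).
  rewrite subr_gt0 => /(_ Kfs); rewrite near_withinE => -[e /= e0 he].
  have [u Au su] := sup_adherent e0 supA.
  have us : u <= s by exact: sup_upper_bound.
  have [/andP[u0 ut] fuK] := Au.
  have : `|f s - f u| < f s - K.
    apply: he; last by rewrite in_itv/= u0 (le_trans ut).
    rewrite /ball_/= ger0_norm ?subr_ge0//.
    by move: su; rewrite -/s; lra.
  by apply/negP; rewrite -leNgt (le_trans _ (ler_norm _))//; lra.
have stlt : s < t.
  rewrite lt_neqAle st andbT; apply: contraTneq Kft => <-.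
  by rewrite -leNgt.
have ubs u : A u -> u <= s by exact: sup_upper_bound.
clearbody s.
have Kf u : s < u <= t -> K < f u.
  move=> /andP[su ut]; rewrite ltNge; apply/negP => fuK.
  have : A u by split => //; rewrite ut (le_trans s0)// ltW.
  by move=> /ubs; rewrite leNgt su.
have dfst (u : R) : u \in `]s, t[ -> is_derive u 1 f (df u).
  rewrite in_itv/= => /andP[su ut]; apply: dff.
  by rewrite in_itv/= (le_lt_trans s0)//= (lt_le_trans ut).
have cfst : {within `[s, t], continuous f}.
  apply: continuous_subspaceW cf => u; rewrite /= !in_itv/= => /andP[su ut].
  by rewrite (le_trans s0)//= (le_trans ut).
have [c] := MVT stlt dfst cfst.
rewrite in_itv/= => /andP[sc ct] fc.
have : df c <= 0.
  apply: df0; last by rewrite Kf// sc ltW.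
  by rewrite in_itv/= (le_lt_trans s0)//= (lt_le_trans ct).
by move=> dfc; move: (Kf t); rewrite stlt lexx => /(_ isT); nra.
Qed.

End barrier.

Section enorm_sqr_derive.
Context {R : realType} {d : nat}.

Lemma continuous_enorm : continuous (@enorm R d).
Proof.
have hc i : continuous (fun x : 'rV[R]_d => x ord0 i).
  exact: coord_continuous.
have h : continuous (fun x : 'rV[R]_d => \sum_i x ord0 i ^+ 2).
  apply: continuous_big; first by move=> z; exact: add_continuous.
  move=> i _.
  rewrite (_ : (fun x => _) = (fun x : 'rV[R]_d => x ord0 i * x ord0 i)); last first.
    by apply/funext => x; rewrite expr2.
  by move=> x; exact: (cvgM (hc i x) (hc i x)).
move=> x; apply: (@continuous_comp _ _ _ _ Num.sqrt); first exact: h.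
exact: sqrt_continuous.
Qed.

Lemma is_derive_enorm_sqr (X : R -> 'rV[R]_d) (t : R) (v : 'rV[R]_d) :
  is_derive t 1 X v ->
  is_derive t 1 (fun s => enorm (X s) ^+ 2) (2 * dotv (X t) v).
Proof.
move=> [dX Xv].
have dXi i : is_derive t 1 (fun s => X s ord0 i) (v ord0 i).
  apply: DeriveDef; last by rewrite -Xv derive_mx// mxE.
  by move/derivable_mxP : dX => /(_ ord0 i).
have -> : (fun s => enorm (X s) ^+ 2) = \sum_i (fun s => X s ord0 i) ^+ 2.
  by apply/funext => s; rewrite -dotvv /dotv fct_sumE; apply: eq_bigr => i _; rewrite expr2.
rewrite /dotv big_distrr/=; apply: is_derive_sum => i.
apply: is_derive_eq; rewrite expr1 /GRing.scale/=; ring.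
Qed.

End enorm_sqr_derive.

Section derivative_of_integral.
Context {dT} {T : measurableType dT} {R : realType} (P : {finite_measure set T -> \bar R}).

Lemma bounded_integrable (g : T -> R) (C : R) : measurable_fun setT g ->
  (forall x, `|g x| <= C) -> P.-integrable setT (EFin \o g).
Proof.
move=> mg gC; apply: measurable_bounded_integrable => //.
  by rewrite -ge0_fin_numE// fin_num_measure.
exists C; split; first exact: num_real.
by move=> M CM x _; apply: (le_trans (gC x)); exact: ltW.
Qed.

Variables (F dF : R -> T -> R) (b C M : R).
Hypothesis mF : forall t : R, t \in `[0, b] -> measurable_fun setT (F t).
Hypothesis FM : forall (t : R) x, t \in `[0, b] -> `|F t x| <= M.
Hypothesis cF : forall x, {within `[0, b], continuous (F ^~ x)}.
Hypothesis derF : forall (t : R) x, t \in `]0, b[ -> is_derive t 1 (F ^~ x) (dF t x).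
Hypothesis dFC : forall (t : R) x, t \in `]0, b[ -> `|dF t x| <= C.

(** Differentiation under the integral sign; on a finite measure space the constant [|C|] is an
    integrable dominating function. *)
Lemma is_derive_integral t : t \in `]0, b[ ->
  is_derive t 1 (fun s => \int[P]_x F s x) (\int[P]_x dF t x).
Proof.
move=> tb; have C0 : 0 <= `|C| := normr_ge0 C.
have sub s : `]0, b[%classic s -> s \in `[0, b].
  by rewrite /= !in_itv/= => /andP[/ltW -> /ltW ->].
have d1 s x : s \in `]0, b[ -> partial1of2 F s x = dF s x.
  by move=> sb; rewrite partial1of2E; case: (derF x sb).
have intF s : `]0, b[%classic s -> P.-integrable setT (EFin \o F s).
  move=> /sub sb; apply: (@bounded_integrable _ M); [exact: mF|by move=> x; exact: FM].
have dF1 s x : `]0, b[%classic s -> setT x -> derivable (F ^~ x) s 1.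
  by move=> sb _; case: (derF x sb).
have intC : P.-integrable setT (EFin \o cst `|C|).
  by apply: (@bounded_integrable _ `|C|) => // x; rewrite normr_id.
have ub s x : `]0, b[%classic s -> setT x -> `|partial1of2 F s x| <= cst `|C| x.
  by move=> sb _; rewrite d1// (le_trans (dFC x sb))// ler_norm.
apply: DeriveDef.
  exact: (derivable_under_integral measurableT tb intF dF1 _ intC ub).
rewrite -derive1E (differentiation_under_integral measurableT tb intF dF1 _ intC ub)//.
by apply: eq_Rintegral => x _; rewrite d1.
Qed.

(** By the mean value theorem the integrands are Lipschitz in time with the common constant [|C|],
    so their integral is Lipschitz. This covers the endpoints of the interval, where no derivative
    is given. *)
Lemma continuous_integral : {within `[0, b], continuous (fun s => \int[P]_x F s x)}.
Proof.
have lip (s t : R) x : 0 <= s -> s <= t -> t <= b -> `|F t x - F s x| <= `|C| * (t - s).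
  move=> s0 st tb.
  move: st; rewrite le_eqVlt => /predU1P[->|st]; first by rewrite !subrr normr0 mulr0.
  have dst (u : R) : u \in `]s, t[ -> is_derive u 1 (F ^~ x) (dF u x).
    rewrite in_itv/= => /andP[su ut]; apply: derF.
    by rewrite in_itv/= (le_lt_trans s0)//= (lt_le_trans ut).
  have cst : {within `[s, t], continuous (F ^~ x)}.
    apply: (continuous_subspaceW _ (@cF x)) => u; rewrite /= !in_itv/= => /andP[su ut].
    by rewrite (le_trans s0)//= (le_trans ut).
  have [c cst' ->] := MVT st dst cst.
  rewrite normrM (@ger0_norm _ (t - s)) ?subr_ge0 ?(ltW st)//.
  rewrite ler_wpM2r ?subr_ge0 ?(ltW st)//.
  rewrite (le_trans (dFC x _)) ?ler_norm//; move: cst'; rewrite !in_itv/= => /andP[sc ct].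
  by rewrite (le_lt_trans s0)//= (lt_le_trans ct).
have lip2 (s t : R) x : s \in `[0, b] -> t \in `[0, b] -> `|F t x - F s x| <= `|C| * `|t - s|.
  rewrite !in_itv/= => /andP[s0 sb] /andP[t0 tb].
  have [st|/ltW ts] := leP s t; first by rewrite (@ger0_norm _ (t - s)) ?subr_ge0// lip.
  by rewrite distrC (distrC t) (@ger0_norm _ (s - t)) ?subr_ge0// lip.
have intF s : s \in `[0, b] -> P.-integrable setT (EFin \o F s).
  by move=> sb; apply: (@bounded_integrable _ M); [exact: mF|move=> x; exact: FM].
apply/subspace_continuousP => t tb; apply/cvgrPdist_le => e e0.
(* The added 1 makes [D] positive, so that one may divide by it. *)
pose D := `|C| * fine (P setT) + 1.
have D0 : 0 < D by rewrite ltr_wpDl// mulr_ge0// fine_ge0.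
rewrite near_withinE; near=> s => sb.
have intFB := integrableB measurableT (intF _ tb) (intF _ sb).
rewrite -RintegralB ?intF//; apply: (le_trans (le_normr_Rintegral _ _)) => //.
apply: (@le_trans _ _ (\int[P]_x (`|C| * `|t - s|))).
  apply: le_Rintegral => //.
  - exact: integrable_norm.
  - by apply: (@bounded_integrable _ (`|C| * `|t - s|)) => // x; rewrite ger0_norm ?mulr_ge0.
  - by move=> x _; exact: lip2.
rewrite Rintegral_cst// mulrAC (@le_trans _ _ (D * `|t - s|))//.
  by rewrite ler_wpM2r// /D lerDl.
rewrite mulrC -ler_pdivlMr//; near: s.
by apply: cvgr_dist_le => //; exact: divr_gt0.
Unshelve. all: by end_near. Qed.

End derivative_of_integral.

(** * Convolutions with the kernel *)

Section euclidean_measurability.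
Context {R : realType} {d : nat} {dT : measure_display} {T : measurableType dT}.
Implicit Types f g : T -> 'rV[R]_d.

Lemma measurable_fun_coord f i : measurable_fun setT f ->
  measurable_fun setT (fun z => f z ord0 i).
Proof. by move=> mf; exact: (measurableT_comp (measurable_coord i) mf). Qed.

Lemma measurable_dotv f g : measurable_fun setT f -> measurable_fun setT g ->
  measurable_fun setT (fun z => dotv (f z) (g z)).
Proof.
move=> mf mg; apply: measurable_sum => i.
by apply: measurable_funM; exact: measurable_fun_coord.
Qed.

Lemma measurable_enorm f : measurable_fun setT f ->
  measurable_fun setT (fun z => enorm (f z)).
Proof.
move=> mf.
rewrite (_ : (fun z => _) = (fun z => (\sum_i f z ord0 i ^+ 2) `^ 2^-1)); last first.
  by apply/funext => z; rewrite powR12_sqrt//; apply: sumr_ge0 => i _; exact: sqr_ge0.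
apply: (measurableT_comp (measurable_powR _)).
by apply: measurable_sum => i; apply: measurable_funX; exact: measurable_fun_coord.
Qed.

Lemma measurable_enorm_powR f s : measurable_fun setT f ->
  measurable_fun setT (fun z => enorm (f z) `^ s).
Proof.
move=> mf; apply: (measurableT_comp (measurable_powR s)).
exact: measurable_enorm.
Qed.

Lemma measurable_rVB f g : measurable_fun setT f -> measurable_fun setT g ->
  measurable_fun setT (fun z => f z - g z).
Proof.
move=> mf mg; apply: measurable_fun_rV => i.
rewrite (_ : (fun z => _) = (fun z => f z ord0 i - g z ord0 i)); last first.
  by apply/funext => z; rewrite !mxE.
by apply: measurable_funB; exact: measurable_fun_coord.
Qed.

Lemma measurable_rVZ (c : T -> R) f : measurable_fun setT c ->
  measurable_fun setT f -> measurable_fun setT (fun z => c z *: f z).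
Proof.
move=> mc mf; apply: measurable_fun_rV => i.
rewrite (_ : (fun z => _) = (fun z => c z * f z ord0 i)); last first.
  by apply/funext => z; rewrite !mxE.
by apply: measurable_funM => //; exact: measurable_fun_coord.
Qed.

Lemma kernel_KE (s : R) (x : 'rV[R]_d) :
  kernel_K s x = ((1 + s) * enorm x `^ (s - 1)) *: x.
Proof. by rewrite /kernel_K; case: eqVneq => // ->; rewrite scaler0. Qed.

Lemma measurable_kernel s f : measurable_fun setT f ->
  measurable_fun setT (fun z => kernel_K s (f z)).
Proof.
move=> mf; rewrite (_ : (fun z => _) = (fun z => ((1 + s) * enorm (f z) `^ (s - 1)) *: f z)).
  apply: measurable_rVZ => //; apply: measurable_funM => //.
  exact: measurable_enorm_powR.
by apply/funext => z; rewrite kernel_KE.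
Qed.

Lemma measurable_layer n s k f : measurable_fun setT f ->
  measurable_fun setT (fun z => layer n s k (f z)).
Proof.
move=> mf; rewrite /layer /layer_weight.
rewrite (_ : (fun z => _) = (fun z =>
    if k.+1%:R <= n%:R * (Num.max 1 (enorm (f z))) `^ (s - 1) then 1 else 0 : R)); last first.
  by apply/funext => z; case: ifP.
apply: measurable_fun_ifT => //; apply: measurable_fun_ler => //.
apply: measurable_funM => //; apply: (measurableT_comp (measurable_powR _)).
by apply: measurable_maxr => //; exact: measurable_enorm.
Qed.

End euclidean_measurability.

Section vector_integral.
Context {R : realType} {d : nat} {dT : measure_display} {T : measurableType dT}.
Variable m : {measure set T -> \bar R}.

Definition vint (e : T -> 'rV[R]_d) : 'rV[R]_d := \row_i \int[m]_z (e z ord0 i).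

Lemma integrable_Rsum (I : Type) (s : seq I) (h : I -> T -> R) :
  (forall i, m.-integrable setT (EFin \o h i)) ->
  m.-integrable setT (EFin \o (fun z => \sum_(i <- s) h i z)).
Proof.
move=> ih; rewrite (_ : _ \o _ = (fun z => \sum_(i <- s) (h i z)%:E)%E).
  by apply: integrable_sum => // i _; exact: ih.
by apply/funext => z /=; rewrite sumEFin.
Qed.

Lemma Rintegral_sum (I : Type) (s : seq I) (h : I -> T -> R) :
  (forall i, m.-integrable setT (EFin \o h i)) ->
  \int[m]_z (\sum_(i <- s) h i z) = \sum_(i <- s) \int[m]_z h i z.
Proof.
move=> ih; rewrite [RHS]sum_fine; last by move=> i _; exact: integrable_fin_num (ih i).
rewrite /Rintegral; congr fine.
under eq_integral do rewrite -sumEFin.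
by rewrite integral_sum// => i; exact: ih.
Qed.

Lemma integrable_dotv (u : 'rV[R]_d) (e : T -> 'rV[R]_d) :
  (forall i, m.-integrable setT (EFin \o (fun z => e z ord0 i))) ->
  m.-integrable setT (EFin \o (fun z => dotv u (e z))).
Proof.
by move=> ie; apply: integrable_Rsum => i; exact: (integrableZl measurableT _ (ie i)).
Qed.

Lemma dotv_vint (u : 'rV[R]_d) (e : T -> 'rV[R]_d) :
  (forall i, m.-integrable setT (EFin \o (fun z => e z ord0 i))) ->
  \int[m]_z dotv u (e z) = dotv u (vint e).
Proof.
move=> ie; rewrite Rintegral_sum => [|i].
  by apply: eq_bigr => i _; rewrite RintegralZl// mxE.
exact: (integrableZl measurableT _ (ie i)).
Qed.

End vector_integral.

Section kernel_convolution.
Context {R : realType} {d : nat} {dT : measure_display} {T : measurableType dT}.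
Variables (m : {finite_measure set T -> \bar R}) (Z : T -> 'rV[R]_d) (s : R).
Hypotheses (mZ : measurable_fun setT Z) (s01 : 0 <= s <= 1).
Hypothesis iZ : m.-integrable setT (EFin \o (fun z => enorm (Z z))).

(** The convolution of the kernel with the law of [Z] under [m]. This form serves both for
    [omega dx], with [Z] the identity, and for the law of the flow at a given time, with no density
    involved. *)
Definition kconv (x : 'rV[R]_d) := vint m (fun z => kernel_K s (x - Z z)).

Lemma integrable_Rcst (c : R) : m.-integrable setT (EFin \o (fun=> c)).
Proof. by apply: (@bounded_integrable _ _ _ _ _ `|c|). Qed.

Lemma integrable_affine_enorm (b c : R) :
  m.-integrable setT (EFin \o (fun z => b + c * enorm (Z z))).
Proof.
exact: (integrableD measurableT (integrable_Rcst b) (integrableZl measurableT c iZ)).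
Qed.

Lemma integrable_kernel_coord x i :
  m.-integrable setT (EFin \o (fun z => kernel_K s (x - Z z) ord0 i)).
Proof.
apply: le_integrable (integrable_affine_enorm (2 * (1 + enorm x)) 2) => //.
  apply/measurable_EFinP/measurable_fun_coord/measurable_kernel.
  by apply: measurable_rVB.
move=> z _ /=; rewrite lee_fin (le_trans (normr_kernel_coord _ _ s01))//.
rewrite (le_trans _ (ler_norm _))// -mulrDr ler_wpM2l// -addrA lerD2l.
exact: ler_enormB.
Qed.

Lemma integrable_dotv_kernel u x :
  m.-integrable setT (EFin \o (fun z => dotv u (kernel_K s (x - Z z)))).
Proof. by apply: integrable_dotv => i; exact: integrable_kernel_coord. Qed.

Lemma dotv_kconv u x : dotv u (kconv x) = \int[m]_z dotv u (kernel_K s (x - Z z)).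
Proof. by rewrite dotv_vint// => i; exact: integrable_kernel_coord. Qed.

Let W := fine (m setT).

Lemma Rintegral_affine_enorm (b c : R) :
  \int[m]_z (b + c * enorm (Z z)) = b * W + c * \int[m]_z enorm (Z z).
Proof.
rewrite RintegralD ?RintegralZl ?Rintegral_cst//; first exact: integrable_Rcst.
exact: (integrableZl measurableT c iZ).
Qed.

Lemma normr_dotv_kconv x : `|dotv x (kconv x)| <=
  (1 + s) * (enorm x `^ s * (enorm x * W + \int[m]_z enorm (Z z))).
Proof.
rewrite dotv_kconv (le_trans (le_normr_Rintegral _ (integrable_dotv_kernel x x)))//.
set c := (1 + s) * enorm x `^ s.
have -> : (1 + s) * (enorm x `^ s * (enorm x * W + \int[m]_z enorm (Z z))) =
          \int[m]_z (c * enorm x + c * enorm (Z z)).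
  by rewrite Rintegral_affine_enorm /c; ring.
apply: le_Rintegral => //.
- exact: integrable_norm (integrable_dotv_kernel x x).
- exact: integrable_affine_enorm.
- by move=> z _; rewrite (le_trans (ler_dotv_kernel_rep _ _ s01))// /c -mulrDr mulrA.
Qed.

Lemma dotv_kconv_ge x :
  m.-integrable setT (EFin \o (fun z => enorm (Z z) `^ (1 + s))) ->
  (1 + s) * (W * enorm x `^ (1 + s) - 5 * \int[m]_z enorm (Z z) * enorm x `^ s
     - 4 * \int[m]_z enorm (Z z) `^ (1 + s)) <= dotv x (kconv x).
Proof.
move=> iZs; rewrite dotv_kconv.
set b := (1 + s) * enorm x `^ (1 + s); set c := - ((1 + s) * (5 * enorm x `^ s)).
set e := - ((1 + s) * 4).
have ie : m.-integrable setT (EFin \o (fun z => e * enorm (Z z) `^ (1 + s))).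
  exact: (integrableZl measurableT e iZs).
have -> : (1 + s) * (W * enorm x `^ (1 + s) - 5 * \int[m]_z enorm (Z z) * enorm x `^ s
     - 4 * \int[m]_z enorm (Z z) `^ (1 + s)) =
     \int[m]_z (b + c * enorm (Z z) + e * enorm (Z z) `^ (1 + s)).
  rewrite RintegralD ?RintegralZl ?Rintegral_affine_enorm//; first by rewrite /b /c /e; ring.
  exact: integrable_affine_enorm.
apply: le_Rintegral => //.
- exact: (integrableD measurableT (integrable_affine_enorm b c) ie).
- exact: integrable_dotv_kernel.
- move=> z _; rewrite (le_trans _ (ger_dotv_kernel_att x (Z z) s01))//.
  rewrite le_eqVlt; apply/orP; left; apply/eqP; rewrite /b /c /e; ring.
Qed.

End kernel_convolution.

(** * Averaged repulsion *)

Section bounded_fubini.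
Context {R : realType} {dT : measure_display} {T : measurableType dT}.
Variables (P : {finite_measure set T -> \bar R}) (G : T * T -> R) (C : R).
Hypotheses (mG : measurable_fun setT G) (GC : forall z, `|G z| <= C).

Let iG : (P \x P)%E.-integrable setT (EFin \o G).
Proof.
apply: measurable_bounded_integrable => //.
  have /= := @product_measure1E _ _ _ _ _ P P setT setT measurableT measurableT.
  rewrite setXTT => ->.
  by rewrite -ge0_fin_numE ?mule_ge0// fin_numM// fin_num_measure.
exists C; split; first exact: num_real.
by move=> M CM x _; apply: (le_trans (GC x)); exact: ltW.
Qed.

Let iG1 z : P.-integrable setT (EFin \o (fun w => G (z, w))).
Proof.
apply: (@bounded_integrable _ _ _ P _ C) => // w.
by apply: measurableT_comp => //; exact: measurable_pair1.
Qed.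

Let iG2 w : P.-integrable setT (EFin \o (fun z => G (z, w))).
Proof.
apply: (@bounded_integrable _ _ _ P _ C) => // z.
by apply: measurableT_comp => //; exact: measurable_pair2.
Qed.

Lemma integrable_bounded_fubini :
  P.-integrable setT (EFin \o (fun z => \int[P]_w G (z, w))).
Proof.
apply: eq_integrable (integrable_fubini_F iG) => // z _ /=.
by rewrite /Rintegral fineK//; exact: integrable_fin_num (iG1 z).
Qed.

Lemma bounded_fubini :
  \int[P]_z \int[P]_w G (z, w) = \int[P]_w \int[P]_z G (z, w).
Proof.
rewrite /Rintegral; congr fine.
transitivity (\int[P]_z \int[P]_w (EFin \o G) (z, w))%E.
  apply: eq_integral => z _; rewrite fineK//; exact: integrable_fin_num (iG1 z).
rewrite (Fubini iG); apply: eq_integral => w _.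
by rewrite fineK//; exact: integrable_fin_num (iG2 w).
Qed.

End bounded_fubini.

Section averaged_repulsion.
Context {R : realType} {d : nat} {dT : measure_display} {T : measurableType dT}.
Variables (P : {finite_measure set T -> \bar R}) (Y : T -> 'rV[R]_d) (s L : R).
Hypotheses (P1 : P setT = 1%E) (mY : measurable_fun setT Y) (s01 : 0 <= s <= 1).
Hypothesis YL : forall z, enorm (Y z) <= L.

(** Total mass 1 rules out an empty space, and any point [z] gives [0 <= |Y z| <= L]. *)
Let L0 : 0 <= L.
Proof.
have [[z _]|T0] := pselect (exists z : T, True).
  exact: le_trans (enorm_ge0 _) (YL z).
have : P setT = 0%E.
  rewrite (_ : setT = set0) ?measure0//.
  by apply/seteqP; split => // z _; apply: T0; exists z.
by rewrite P1 => /eqP; rewrite eqe oner_eq0.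
Qed.

Lemma Rintegral_prob_cst (c : R) : \int[P]_z c = c.
Proof.
transitivity (c * fine (P setT)); first by rewrite Rintegral_cst.
by rewrite P1 mulr1.
Qed.

Lemma integrable_enorm_powR q : 0 <= q ->
  P.-integrable setT (EFin \o (fun z => enorm (Y z) `^ q)).
Proof.
move=> q0; apply: (@bounded_integrable _ _ _ P _ (L `^ q)).
  exact: measurable_enorm_powR.
move=> z; rewrite ger0_norm ?powR_ge0//.
by apply: ge0_ler_powR => //; rewrite nnegrE ?enorm_ge0 .
Qed.

Lemma integrable_bounded_coord (c : T -> R) i : measurable_fun setT c ->
  (forall z, 0 <= c z <= 1) ->
  P.-integrable setT (EFin \o (fun z => (c z *: Y z) ord0 i)).
Proof.
move=> mc c01; apply: (@bounded_integrable _ _ _ P _ L).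
  exact/measurable_fun_coord/measurable_rVZ.
move=> z; have /andP[c0 c1] := c01 z; rewrite mxE normrM ger0_norm//.
rewrite -[leRHS]mul1r ler_pM//.
exact: le_trans (ler_coord_enorm _ _) (YL z).
Qed.

(* Exchanging the two variables turns the integrand into
   [(1 + s) / 2 |Y z - Y w|^(1 + s)]; the layers contribute minus a sum of
   squares. *)
Lemma averaged_repulsion_le :
  \int[P]_z dotv (Y z) (kconv P Y s (Y z)) <=
  (1 + s) * (\int[P]_z enorm (Y z) `^ (1 + s) + 4).
Proof.
have arith (J s' m' v : R) : 0 <= s' -> 0 <= v ->
    J + J <= (1 + s') * (m' + m' + 8 - v) -> J <= (1 + s') * (m' + 4).
  by move=> *; nra.
have /andP[s0 s1] := s01.
(* Enough layers for the rounding error to be at most 1 on the ball of radius [L]. *)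
pose n := (Num.trunc (L ^+ 2)).+1.
have n0 : (0 < n)%N by [].
have Ln : L ^+ 2 <= n%:R by apply/ltW/truncnS_gt.
pose e k z : 'rV[R]_d := layer n s k (Y z) *: Y z.
have lay01 k z : 0 <= layer n s k (Y z) <= 1 by rewrite /layer ler0n lern1 leq_b1.
have mlay k : measurable_fun setT (fun z => layer n s k (Y z)) by exact: measurable_layer.
have ie k i : P.-integrable setT (EFin \o (fun z => e k z ord0 i)).
  exact: integrable_bounded_coord.
have iY : P.-integrable setT (EFin \o (fun z => enorm (Y z))).
  apply: (@bounded_integrable _ _ _ P _ L); first exact: measurable_enorm.
  by move=> z; rewrite ger0_norm ?enorm_ge0.
set m := \int[P]_z enorm (Y z) `^ (1 + s).
have iq := @integrable_enorm_powR (1 + s) (addr_ge0 ler01 s0).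
pose G (zw : T * T) := dotv (Y zw.1) (kernel_K s (Y zw.1 - Y zw.2)).
pose G' (zw : T * T) := dotv (Y zw.2) (kernel_K s (Y zw.2 - Y zw.1)).
have mY1 : measurable_fun setT (fun zw : T * T => Y zw.1) by exact: measurableT_comp.
have mY2 : measurable_fun setT (fun zw : T * T => Y zw.2) by exact: measurableT_comp.
have mG : measurable_fun setT G.
  by apply: measurable_dotv => //; apply: measurable_kernel; exact: measurable_rVB.
have mG' : measurable_fun setT G'.
  by apply: measurable_dotv => //; apply: measurable_kernel; exact: measurable_rVB.
pose C := (1 + s) * (L `^ s * (L + L)).
have GC0 z w : `|dotv (Y z) (kernel_K s (Y z - Y w))| <= C.
  apply: (le_trans (ler_dotv_kernel_rep _ _ s01)); rewrite ler_wpM2l ?addr_ge0//.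
  rewrite ler_pM ?powR_ge0 ?addr_ge0 ?enorm_ge0 ?lerD//.
  by apply: ge0_ler_powR => //; rewrite nnegrE ?enorm_ge0 .
have GC zw : `|G zw| <= C by exact: GC0.
have GC' zw : `|G' zw| <= C by exact: GC0.
set I := (X in X <= _).
have I1 : I = \int[P]_z \int[P]_w G (z, w).
  by apply: eq_Rintegral => z _; rewrite (dotv_kconv mY s01 iY).
have I2 : I = \int[P]_z \int[P]_w G' (z, w).
  transitivity (\int[P]_w \int[P]_z G (z, w)); first by rewrite I1; exact: bounded_fubini mG GC.
  by apply: eq_Rintegral => w _; apply: eq_Rintegral => z _; rewrite /G /G'.
have i1 := integrable_bounded_fubini P mG GC.
have i2 := integrable_bounded_fubini P mG' GC'.
pose c := (1 + s) / n%:R.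
pose V := \sum_(k < n) dotv (vint P (e k)) (vint P (e k)).
have V0 : 0 <= V by apply: sumr_ge0 => k _; rewrite dotvv sqr_ge0.
suff : I + I <= (1 + s) * (m + m + 8 - c * V).
  have c0 : 0 <= c by rewrite /c divr_ge0// addr_ge0.
  exact: arith s0 (mulr_ge0 c0 V0).
rewrite {1}I1 I2 -(RintegralD measurableT i1 i2).
have iW z k : P.-integrable setT (EFin \o (fun w => dotv (e k z) (e k w))).
  exact: integrable_dotv.
have inner z : \int[P]_w G (z, w) + \int[P]_w G' (z, w) <=
    (1 + s) * (enorm (Y z) `^ (1 + s) + (m + 8) -
               c * \sum_(k < n) dotv (vint P (e k)) (e k z)).
  have iG1 : P.-integrable setT (EFin \o (fun w => G (z, w))).
    apply: (@bounded_integrable _ _ _ P _ C) => //.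
    by apply: measurableT_comp => //; exact: measurable_pair1.
  have iG2 : P.-integrable setT (EFin \o (fun w => G' (z, w))).
    apply: (@bounded_integrable _ _ _ P _ C) => //.
    by apply: measurableT_comp => //; exact: measurable_pair1.
  have iS : P.-integrable setT (EFin \o (fun w => \sum_(k < n) dotv (e k z) (e k w))).
    by apply: integrable_Rsum => k; exact: iW.
  have icS := integrableZl measurableT c iS.
  have iA : P.-integrable setT (EFin \o (fun w => enorm (Y z) `^ (1 + s) + 8 + enorm (Y w) `^ (1 + s))).
    exact: (integrableD measurableT (integrable_Rcst P _) iq).
  have iB := integrableB measurableT iA icS.
  have iC := integrableZl measurableT (1 + s) iB.
  rewrite -RintegralD//.
  apply: (@le_trans _ _ (\int[P]_w ((1 + s) * (enorm (Y z) `^ (1 + s) + 8 + enorm (Y w) `^ (1 + s)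
      - c * \sum_(k < n) dotv (e k z) (e k w))))).
    apply: le_Rintegral => //; first exact: (integrableD measurableT iG1 iG2).
    move=> w _; rewrite /G /G'/= -(opprB (Y z)).
    (* The kernel is odd, so the two orders of the pair combine into
       [(Y z - Y w) . K(Y z - Y w)]. *)
    have -> : dotv (Y z) (kernel_K s (Y z - Y w)) +
        dotv (Y w) (kernel_K s (- (Y z - Y w))) =
        dotv (Y z - Y w) (kernel_K s (Y z - Y w)).
      have -> : kernel_K s (- (Y z - Y w)) = - kernel_K s (Y z - Y w).
        by rewrite !kernel_KE enormN scalerN.
      by rewrite dotvNr dotvC [in X in _ - X]dotvC [RHS]dotvC dotvDr dotvNr.
    rewrite dotv_kernel_sub// ler_wpM2l ?addr_ge0//.
    rewrite (le_trans (enormB_powR_le_layers n0 Ln s01 (YL z) (YL w)))//.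
    by rewrite [enorm (Y z) `^ (1 + s) + 8 + _]addrAC.
  rewrite RintegralZl// ler_wpM2l ?addr_ge0// RintegralB// RintegralD ?integrable_Rcst//.
  rewrite Rintegral_prob_cst -/m RintegralZl//.
  have -> : \int[P]_w (\sum_(k < n) dotv (e k z) (e k w)) =
            \sum_(k < n) dotv (vint P (e k)) (e k z).
    rewrite Rintegral_sum; last by move=> k; exact: iW.
    by apply: eq_bigr => k _; rewrite dotvC -dotv_vint.
  by rewrite [m + 8]addrC [_ + (8 + m)]addrA.
have iV k : P.-integrable setT (EFin \o (fun z => dotv (vint P (e k)) (e k z))).
  exact: integrable_dotv.
have iS : P.-integrable setT (EFin \o (fun z => \sum_(k < n) dotv (vint P (e k)) (e k z))).
  by apply: integrable_Rsum => k; exact: iV.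
have icS := integrableZl measurableT c iS.
have iA : P.-integrable setT (EFin \o (fun z => enorm (Y z) `^ (1 + s) + (m + 8))).
  exact: (integrableD measurableT iq (integrable_Rcst P _)).
have iB := integrableB measurableT iA icS.
have iC := integrableZl measurableT (1 + s) iB.
apply: (@le_trans _ _ (\int[P]_z ((1 + s) * (enorm (Y z) `^ (1 + s) + (m + 8) -
               c * \sum_(k < n) dotv (vint P (e k)) (e k z))))).
  apply: le_Rintegral => //; first exact: (integrableD measurableT i1 i2).
rewrite (RintegralZl (1 + s) measurableT iB) ler_wpM2l ?addr_ge0//.
rewrite (RintegralB measurableT iA icS) (RintegralD measurableT iq (integrable_Rcst P (m + 8))).
rewrite Rintegral_prob_cst -/m (RintegralZl c measurableT iS).
have -> : \int[P]_z (\sum_(k < n) dotv (vint P (e k)) (e k z)) = V.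
  rewrite Rintegral_sum; last by move=> k; exact: iV.
  by apply: eq_bigr => k _; rewrite dotv_vint.
by rewrite [m + (m + 8)]addrA.
Qed.

End averaged_repulsion.

(** * Gronwall's lemma *)

Section gronwall.
Context {R : realType}.

(** The function [(1 + f t) exp(-K t)] has nonpositive derivative, so [barrier_le] keeps it below
    its initial value. *)
Lemma gronwall_le (f df : R -> R) (b K : R) : {within `[0, b], continuous f} ->
  (forall t : R, t \in `]0, b[ -> is_derive t 1 f (df t)) ->
  (forall t : R, t \in `]0, b[ -> df t <= K * (1 + f t)) ->
  forall t : R, t \in `[0, b] -> 1 + f t <= (1 + f 0) * expR (K * t).
Proof.
move=> cf dff dfK t tb.
pose g := (cst 1 + f) * (expR \o ( *%R (- K))).
pose dg u := (df u - K * (1 + f u)) * expR (- K * u).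
have dgg (u : R) : u \in `]0, b[ -> is_derive u 1 g (dg u).
  move=> ub; have := dff u ub => dfu.
  have dM : is_derive u 1 ( *%R (- K)) (- K).
    have -> : *%R (- K) = (- K) \*: (id : R -> R) by [].
    by apply: is_derive_eq; rewrite /GRing.scale/= mulr1.
  apply: is_derive_eq; rewrite /dg /GRing.scale/= !fctE; ring.
have cg : {within `[0, b], continuous g}.
  have ce : continuous (expR \o ( *%R (- K))).
    move=> u; apply: continuous_comp; first exact: mulrl_continuous.
    exact: continuous_expR.
  have ce' : {within `[0, b], continuous (expR \o ( *%R (- K)))}.
    exact: continuous_subspaceT.
  move=> u; apply: cvgM; last exact: ce'.
  by apply: cvgD; [exact: cvg_cst|exact: cf].
have g0 : g 0 <= 1 + f 0 by rewrite /g !fctE/= mulr0 expR0 mulr1.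
have := barrier_le cg dgg g0 _ tb.
rewrite /g !fctE/= mulNr expRN ler_pdivrMr ?expR_gt0//; apply.
move=> u ub _; rewrite /dg mulr_le0_ge0 ?expR_ge0// subr_le0.
exact: dfK.
Qed.

End gronwall.

(** * Measurability of integrals depending on a parameter *)

Section measurable_parameter_integral.
Context {R : realType} {d1 d2 : measure_display}.
Context {T1 : measurableType d1} {T2 : measurableType d2}.

Lemma measurable_Rintegral_parameter (m : {sigma_finite_measure set T2 -> \bar R})
    (G : T1 * T2 -> R) : measurable_fun setT G ->
  measurable_fun setT (fun x => \int[m]_y G (x, y)).
Proof.
move=> mG; have mG' : measurable_fun setT (EFin \o G) by exact/measurable_EFinP.
rewrite /Rintegral; apply: (measurableT_comp (@fine_measurable R _ measurableT)).
rewrite (_ : (fun x => _) = (fun x => \int[m]_y (EFin \o G)^\+%E (x, y) -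
    \int[m]_y (EFin \o G)^\-%E (x, y))%E); last first.
  apply/funext => x; rewrite integralE; congr (_ - _)%E.
    by apply: eq_integral => y _; rewrite !funeposE.
  by apply: eq_integral => y _; rewrite !funenegE.
apply: emeasurable_funB.
  by apply: measurable_fun_fubini_tonelli_F => //; exact: measurable_funepos.
by apply: measurable_fun_fubini_tonelli_F => //; exact: measurable_funeneg.
Qed.

Lemma measurable_kconv d (m : {sigma_finite_measure set T2 -> \bar R}) (Z : T2 -> 'rV[R]_d) (s : R)
    (f : T1 -> 'rV[R]_d) : measurable_fun setT Z -> measurable_fun setT f ->
  measurable_fun setT (fun x => vint m (fun z => kernel_K s (f x - Z z))).
Proof.
move=> mZ mf; apply: measurable_fun_rV => i.
rewrite (_ : (fun x => _) = (fun x => \int[m]_z (kernel_K s (f x - Z z) ord0 i))); last first.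
  by apply/funext => x; rewrite mxE.
apply: (measurable_Rintegral_parameter m (G := fun xz => kernel_K s (f xz.1 - Z xz.2) ord0 i)).
apply: measurable_fun_coord; apply: measurable_kernel.
by apply: measurable_rVB; exact: measurableT_comp.
Qed.

End measurable_parameter_integral.

(** * Confinement *)

Section absorption.
Context {R : realType}.
Implicit Types a r W Ca om X m : R.

(** Beyond [X = 10 C1 / om] the factor [om / 2 * X] exceeds [5 C1]; below it [X^a <= 1 + X] is
    bounded by a constant. *)
Lemma absorb_lower_order a (C1 : R) om X : 0 <= a <= 1 -> 0 <= C1 -> 0 < om -> 0 <= X ->
  5 * C1 * X `^ a <= om / 2 * X `^ (1 + a) + 5 * C1 * (1 + 10 * C1 / om).
Proof.
move=> /[dup] a01 /andP[a0 a1] C10 om0 X0; rewrite powR1D//.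
have Xa := powR_ge0 X a; have C0 : 0 <= 5 * C1 by rewrite mulr_ge0.
have k0 : 0 <= 10 * C1 / om by rewrite divr_ge0 ?mulr_ge0// ltW.
have [Xk|kX] := leP X (10 * C1 / om).
  rewrite (@le_trans _ _ (5 * C1 * (1 + 10 * C1 / om)))//.
    by rewrite ler_wpM2l// (le_trans (ler_powR_affine X0 a01))// lerD2l.
  by rewrite lerDr !mulr_ge0// ltW.
rewrite (@le_trans _ _ (om / 2 * (X * X `^ a)))//; last first.
  by rewrite lerDl mulr_ge0// addr_ge0.
rewrite mulrA ler_wpM2r//; move: kX; rewrite ltr_pdivrMr// => kX; lra.
Qed.

Lemma attraction_ge a W (C1 : R) Ca X : 0 <= a -> 0 <= Ca -> 1 <= X ->
  X `^ a * (W * X - (5 * C1 + 4 * Ca)) <=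
  W * X `^ (1 + a) - 5 * C1 * X `^ a - 4 * Ca.
Proof.
move=> a0 Ca0 X1; rewrite powR1D//; last exact: le_trans X1.
have : 1 <= X `^ a by rewrite -(powRr0 X) ler_powR.
by move: (X `^ a) => x x1; nra.
Qed.

(** After division by the common power [X^a], the excess [(W - 1) X] is shared equally: one half
    covers [m], the other the error [5 C1 + 4 Ca] of the attraction. *)
Lemma barrier_equal a W (C1 : R) Ca X m : 0 <= a -> 0 <= Ca -> 1 < W ->
  1 <= X -> 2 * (5 * C1 + 4 * Ca) / (W - 1) <= X -> m <= (W - 1) / 2 * X ->
  (1 + a) * (X `^ a * (X + m)) <=
  (1 + a) * (W * X `^ (1 + a) - 5 * C1 * X `^ a - 4 * Ca).
Proof.
move=> a0 Ca0 W1 X1; rewrite ler_pdivrMr ?subr_gt0// => hX hm.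
rewrite ler_wpM2l ?addr_ge0// (le_trans _ (attraction_ge _ _ _ _ _))//.
by rewrite ler_wpM2l ?powR_ge0//; lra.
Qed.

(** The last threshold on [X] gives [W X^a >= 6 X^r]. Half of the leading attraction absorbs the
    lower order errors, and the other half dominates [3 X * X^r], where [3 X >= X + m]. *)
Lemma barrier_strict a r W (C1 : R) Ca X m : 0 <= r -> r < a -> 0 <= Ca -> 0 < W ->
  1 <= X -> 2 * (5 * C1 + 4 * Ca) / W <= X -> (6 / W) `^ (a - r)^-1 <= X ->
  m <= 2 * X ->
  (1 + r) * (X `^ r * (X + m)) <=
  (1 + a) * (W * X `^ (1 + a) - 5 * C1 * X `^ a - 4 * Ca).
Proof.
move=> r0 ra Ca0 W0 X1; rewrite ler_pdivrMr// => hX hX2 hm.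
have X0 : 0 < X by exact: lt_le_trans X1.
have ar0 : 0 < a - r by rewrite subr_gt0.
have a0 : 0 <= a by rewrite (le_trans r0)// ltW.
have h6 : 6 / W <= X `^ (a - r).
  have /(ge0_ler_powR (ltW ar0)) := hX2.
  rewrite -powRrM mulVf ?gt_eqF// powRr1; last by rewrite divr_ge0// ltW.
  by apply; rewrite nnegrE ?powR_ge0// ltW.
have Xr := powR_ge0 X r.
have hXa : X `^ a = X `^ r * X `^ (a - r).
  by rewrite -powRD ?(gt_eqF X0) ?implybT// addrC subrK.
apply: (@le_trans _ _ ((1 + r) * (X `^ r * (3 * X)))).
  by rewrite ler_wpM2l ?addr_ge0// ler_wpM2l//; lra.
apply: (@le_trans _ _ ((1 + a) * (X `^ r * (3 * X)))).
  apply: ler_wpM2r; last by rewrite lerD2l ltW.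
  by rewrite !mulr_ge0// ltW.
rewrite ler_wpM2l ?addr_ge0// (le_trans _ (attraction_ge _ _ _ _ _))//.
rewrite hXa -mulrA ler_wpM2l//.
move: h6; rewrite ler_pdivrMr// => h6.
have h0 := powR_ge0 X (a - r); move: h6 h0; move: (X `^ (a - r)) => u h6 h0.
apply: (@le_trans _ _ (u * (W * X / 2))); first by nra.
by rewrite ler_wpM2l//; lra.
Qed.

Lemma quadratic_growth X W (C1 : R) m : 0 <= X -> 0 <= W -> 0 <= C1 -> 0 <= m ->
  2 * ((1 + X) * (X + m)) + 2 * ((1 + X) * (X * W + C1)) <=
  4 * (W + 1 + C1 + m) * (1 + X ^+ 2).
Proof.
move=> X0 W0 C10 m0.
apply: (@le_trans _ _ ((W + 1 + C1 + m) * (2 * (1 + X) ^+ 2))).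
  have -> : (W + 1 + C1 + m) * (2 * (1 + X) ^+ 2) =
    2 * ((1 + X) * ((1 + X) * (W + 1 + C1 + m))) by ring.
  rewrite -mulrDr -mulrDr ler_wpM2l// ler_wpM2l ?addr_ge0//.
  by have := mulr_ge0 X0 C10; have := mulr_ge0 X0 m0; nra.
rewrite [4 * _]mulrC -mulrA ler_wpM2l ?addr_ge0//.
by have := sqr_ge0 (1 - X); nra.
Qed.

End absorption.

Section confinement.
Context {R : realType} {d : nat}.
Context {dT : measure_display} {T : measurableType dT}.
Context {dS : measure_display} {S : measurableType dS}.
Variables (P : {finite_measure set T -> \bar R}) (nu : {finite_measure set S -> \bar R}).
Variables (Z : S -> 'rV[R]_d) (a r : R).

(** Position times velocity, that is, half the time derivative of [|Y|^2]; the repulsion comes from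
    the law of [Yt] itself. *)
Definition drift (Yt : T -> 'rV[R]_d) (z : T) : R :=
  dotv (Yt z) (kconv P Yt r (Yt z)) - dotv (Yt z) (kconv nu Z a (Yt z)).

(** What confinement needs of the flow: only [|Y|^2] is followed, for every label without
    exceptional set. The moment bound [M] may depend on the horizon [b]; the final radius depends on
    neither. *)
Record admissible_flow (b M R0 : R) (Y : R -> T -> 'rV[R]_d) : Prop := {
  flow_measurable : forall t : R, t \in `[0, b] -> measurable_fun setT (Y t) ;
  flow_init : forall z, enorm (Y 0 z) <= R0 ;
  flow_continuous : forall z, {within `[0, b], continuous (fun t : R => enorm (Y t z) ^+ 2)} ;
  flow_derive : forall (t : R) z, t \in `]0, b[ ->
    is_derive t 1 (fun u => enorm (Y u z) ^+ 2) (2 * drift (Y t) z) ;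
  flow_integrable : forall t : R, t \in `[0, b] ->
    P.-integrable setT (EFin \o (fun z => enorm (Y t z))) ;
  flow_moment : forall t : R, t \in `[0, b] -> \int[P]_z enorm (Y t z) <= M }.

Hypotheses (P1 : P setT = 1%E) (a01 : 0 <= a <= 1) (r01 : 0 <= r <= 1).
Hypotheses (mZ : measurable_fun setT Z)
  (iZ : nu.-integrable setT (EFin \o (fun z => enorm (Z z))))
  (iZa : nu.-integrable setT (EFin \o (fun z => enorm (Z z) `^ (1 + a)))).

Let W := fine (nu setT).
Let C1 := \int[nu]_z enorm (Z z).
Let Ca := \int[nu]_z enorm (Z z) `^ (1 + a).

Let W0 : 0 <= W. Proof. exact: fine_ge0. Qed.
Let C10 : 0 <= C1. Proof. by apply: Rintegral_ge0 => z _; exact: enorm_ge0. Qed.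
Let Ca0 : 0 <= Ca. Proof. by apply: Rintegral_ge0 => z _; exact: powR_ge0. Qed.

Let attraction x : (1 + a) * (W * enorm x `^ (1 + a) - 5 * C1 * enorm x `^ a - 4 * Ca)
   <= dotv x (kconv nu Z a x).
Proof. exact: dotv_kconv_ge. Qed.

Let repulsion (Yt : T -> 'rV[R]_d) (x : 'rV[R]_d) : measurable_fun setT Yt ->
  P.-integrable setT (EFin \o (fun z => enorm (Yt z))) ->
  `|dotv x (kconv P Yt r x)| <=
  (1 + r) * (enorm x `^ r * (enorm x + \int[P]_z enorm (Yt z))).
Proof.
move=> mY iY; have := normr_dotv_kconv mY r01 iY x.
suff -> : fine (P setT) = 1 by rewrite mulr1.
by rewrite P1.
Qed.

(** Quadratic growth, used in Gronwall's lemma and for differentiating the second moment under the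
    integral sign. *)
Lemma normr_drift_le (M : R) (Yt : T -> 'rV[R]_d) z : measurable_fun setT Yt ->
  P.-integrable setT (EFin \o (fun z => enorm (Yt z))) ->
  \int[P]_z enorm (Yt z) <= M ->
  `|drift Yt z| <= 4 * (W + 1 + C1 + M) * (1 + enorm (Yt z) ^+ 2).
Proof.
move=> mY iY YM.
have M0 : 0 <= M by apply: le_trans YM; apply: Rintegral_ge0 => u _; exact: enorm_ge0.
have h1 := repulsion (Yt z) mY iY.
have h2 := normr_dotv_kconv mZ a01 iZ (Yt z).
rewrite -/W -/C1 in h2.
apply: (le_trans (ler_normB _ _)); apply: (le_trans (lerD h1 h2)).
set X := enorm (Yt z); have X0 : 0 <= X by exact: enorm_ge0.
have h (s u : R) : 0 <= s <= 1 -> 0 <= u -> (1 + s) * (X `^ s * u) <= 2 * ((1 + X) * u).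
  move=> s01 u0; have /andP[s0 s1] := s01.
  have := ler_powR_affine X0 s01; have := powR_ge0 X s; move: (X `^ s) => v v0 vX.
  apply: ler_pM; rewrite ?mulr_ge0 ?addr_ge0//; first by lra.
  exact: ler_wpM2r.
apply: (@le_trans _ _ (2 * ((1 + X) * (X + M)) + 2 * ((1 + X) * (X * W + C1)))).
  apply: lerD; last by rewrite h// addr_ge0// mulr_ge0.
  apply: (@le_trans _ _ ((1 + r) * (X `^ r * (X + M)))).
    by case/andP: r01 => r0 _; rewrite ler_wpM2l ?addr_ge0// ler_wpM2l ?powR_ge0// lerD2l.
  by rewrite h// addr_ge0.
exact: quadratic_growth.
Qed.

Lemma admissible_flow_bounded b M R0 Y : admissible_flow b M R0 Y ->
  exists L, forall (t : R) z, t \in `[0, b] -> enorm (Y t z) <= L.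
Proof.
move=> FY; pose K := 2 * (4 * (W + 1 + C1 + M)).
exists ((1 + R0 ^+ 2) * expR (`|K| * b)) => t z tb.
have Kd (u : R) : u \in `]0, b[ -> 2 * drift (Y u) z <= K * (1 + enorm (Y u z) ^+ 2).
  move=> ub; have ub' : u \in `[0, b].
    by move: ub; rewrite !in_itv/= => /andP[/ltW -> /ltW ->].
  rewrite /K -mulrA ler_wpM2l// (le_trans (ler_norm _))//.
  apply: normr_drift_le; [exact: (flow_measurable FY)|exact: (flow_integrable FY)|exact: (flow_moment FY)].
have := gronwall_le (@flow_continuous _ _ _ _ FY z) (fun u ub => @flow_derive _ _ _ _ FY u z ub) Kd tb.
move: tb; rewrite in_itv/= => /andP[t0 tb].
have := flow_init FY z; set X0 := enorm (Y 0 z); set X := enorm (Y t z).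
have [X00 XX0] : 0 <= X0 /\ 0 <= X by split; exact: enorm_ge0.
(* Since [X <= 1 + X^2], the bound on the square serves directly, without a root. *)
move=> X0R h; apply: (@le_trans _ _ (1 + X ^+ 2)); first by have := sqr_ge0 (1 - X); nra.
apply: (le_trans h); rewrite ler_pM ?expR_ge0 ?addr_ge0 ?sqr_ge0//.
  by rewrite lerD2l ler_pXn2r ?nnegrE// (le_trans X00).
rewrite ler_expR (@le_trans _ _ (`|K| * t))//; first by rewrite ler_wpM2r// ler_norm.
by rewrite ler_wpM2l.
Qed.

(** The constant of [absorb_lower_order] for [om = W - 1], the error [4 Ca] of the attraction, and
    the 4 of the averaged repulsion. *)
Let C2 := 5 * C1 * (1 + 10 * C1 / (W - 1)) + 4 * Ca + 4.

(** Averaged repulsion costs one unit of the moment of order [1 + a]. Attraction supplies [W] units,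
    of which [(W - 1) / 2] are spent on its lower order term; [(W - 1) / 2] remain. *)
Lemma averaged_drift_le (L : R) (Yt : T -> 'rV[R]_d) : a = r -> 1 < W ->
  measurable_fun setT Yt -> (forall z, enorm (Yt z) <= L) ->
  \int[P]_z drift Yt z <=
  (1 + a) * (C2 - (W - 1) / 2 * \int[P]_z enorm (Yt z) `^ (1 + a)).
Proof.
have arith (U V Q x w : R) : V <= (w - 1) / 2 * Q + U ->
  (w + 1) / 2 * Q - (U + x) <= w * Q - V - x by lra.
have arith' (u q c w : R) : (1 + u) * (q + 4) -
    ((1 + u) * ((w + 1) / 2) * q + - (1 + u) * (c - 4)) =
    (1 + u) * (c - (w - 1) / 2 * q) by field.
move=> ar W1 mY YL; have /andP[a0 a1] := a01.
have iY : P.-integrable setT (EFin \o (fun z => enorm (Yt z))).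
  apply: (@bounded_integrable _ _ _ P _ L); first exact: measurable_enorm.
  by move=> z; rewrite ger0_norm ?enorm_ge0.
have powL s z : 0 <= s -> enorm (Yt z) `^ s <= L `^ s.
  move=> s0; have := le_trans (enorm_ge0 _) (YL z) => L0.
  by apply: ge0_ler_powR => //; rewrite nnegrE ?enorm_ge0.
have mk : measurable_fun setT (fun z => kconv P Yt r (Yt z)) by exact: measurable_kconv.
have mk' : measurable_fun setT (fun z => kconv nu Z a (Yt z)) by exact: measurable_kconv.
have iR : P.-integrable setT (EFin \o (fun z => dotv (Yt z) (kconv P Yt r (Yt z)))).
  apply: (@bounded_integrable _ _ _ P _ ((1 + r) * (L `^ r * (L + \int[P]_z enorm (Yt z))))).
    exact: measurable_dotv.
  move=> z; apply: (le_trans (repulsion (Yt z) mY iY)).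
  case/andP: r01 => r0 _; rewrite ler_wpM2l ?addr_ge0//.
  have m0 : 0 <= \int[P]_z enorm (Yt z) by apply: Rintegral_ge0 => u _; exact: enorm_ge0.
  by rewrite ler_pM ?powR_ge0 ?addr_ge0 ?enorm_ge0 ?powL// lerD2r.
have iA : P.-integrable setT (EFin \o (fun z => dotv (Yt z) (kconv nu Z a (Yt z)))).
  apply: (@bounded_integrable _ _ _ P _ ((1 + a) * (L `^ a * (L * W + C1)))).
    exact: measurable_dotv.
  move=> z; apply: (le_trans (normr_dotv_kconv mZ a01 iZ (Yt z))).
  rewrite -/W -/C1 ler_wpM2l ?addr_ge0//.
  by rewrite ler_pM ?powR_ge0 ?addr_ge0 ?mulr_ge0 ?enorm_ge0 ?powL// lerD2r ler_wpM2r.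
rewrite /drift (RintegralB measurableT iR iA).
have hR : \int[P]_z dotv (Yt z) (kconv P Yt r (Yt z)) <=
    (1 + a) * (\int[P]_z enorm (Yt z) `^ (1 + a) + 4).
  by rewrite ar; exact: (averaged_repulsion_le P1 mY r01 YL).
set q := \int[P]_z enorm (Yt z) `^ (1 + a) in hR *.
have iq : P.-integrable setT (EFin \o (fun z => enorm (Yt z) `^ (1 + a))).
  exact: (integrable_enorm_powR P1 mY YL (addr_ge0 ler01 a0)).
pose c := (1 + a) * ((W + 1) / 2); pose e := - (1 + a) * (C2 - 4).
have icq := integrableZl measurableT c iq.
have hA : c * q + e <= \int[P]_z dotv (Yt z) (kconv nu Z a (Yt z)).
  have <- : \int[P]_z (c * enorm (Yt z) `^ (1 + a) + e) = c * q + e.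
    rewrite (RintegralD measurableT icq (integrable_Rcst P e)) (RintegralZl c measurableT iq).
    by rewrite (Rintegral_prob_cst P1).
  apply: (le_Rintegral measurableT _ iA) => [|z _].
    exact: (integrableD measurableT icq (integrable_Rcst P e)).
  apply: (le_trans _ (attraction (Yt z))); rewrite /c /e mulNr -mulrA -mulrBr.
  rewrite ler_wpM2l ?addr_ge0//.
  have om0 : 0 < W - 1 by rewrite subr_gt0.
  have := absorb_lower_order a01 C10 om0 (enorm_ge0 (Yt z)).
  have -> : C2 - 4 = 5 * C1 * (1 + 10 * C1 / (W - 1)) + 4 * Ca by rewrite /C2 addrK.
  exact: arith.
apply: (le_trans (lerB hR hA)); rewrite /c /e.
by rewrite arith'.
Qed.

(** A barrier argument for the second moment: above the stated level, [E|Y|^(1+a) >= E|Y|^2 / L]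
    exceeds [2 C2 / (W - 1)] and the averaged drift is nonpositive. *)
Lemma second_moment_le b M R0 Y L : a = r -> 1 < W -> admissible_flow b M R0 Y ->
  1 <= L -> (forall (t : R) z, t \in `[0, b] -> enorm (Y t z) <= L) ->
  forall t : R, t \in `[0, b] ->
    \int[P]_z enorm (Y t z) ^+ 2 <= (R0 ^+ 2 + 2 * C2 / (W - 1)) * L.
Proof.
have arith (c w q : R) : 2 * c < q * w -> c <= w / 2 * q by lra.
move=> ar W1 FY L1 YL; have /andP[a0 a1] := a01.
have L0 : 0 < L by exact: lt_le_trans L1.
have om0 : 0 < W - 1 by rewrite subr_gt0.
have C20 : 0 <= C2.
  rewrite /C2 !addr_ge0 ?mulr_ge0 ?addr_ge0// divr_ge0 ?mulr_ge0// ltW//.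
pose F (t : R) z := enorm (Y t z) ^+ 2.
pose dF (t : R) z := 2 * drift (Y t) z.
have sub (t : R) : t \in `]0, b[ -> t \in `[0, b].
  by rewrite !in_itv/= => /andP[/ltW -> /ltW ->].
have mF (t : R) : t \in `[0, b] -> measurable_fun setT (F t).
  by move=> tb; apply: measurable_funX; apply: measurable_enorm; exact: (flow_measurable FY).
have FM (t : R) z : t \in `[0, b] -> `|F t z| <= L ^+ 2.
  move=> tb; rewrite ger0_norm ?sqr_ge0// ler_pXn2r ?nnegrE ?enorm_ge0 ?(ltW L0)//.
  exact: YL.
have M0 (t : R) : t \in `[0, b] -> 0 <= M.
  move=> tb; apply: le_trans (flow_moment FY tb).
  by apply: Rintegral_ge0 => u _; exact: enorm_ge0.
pose D := 2 * (4 * (W + 1 + C1 + M) * (1 + L ^+ 2)).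
have dFD (t : R) z : t \in `]0, b[ -> `|dF t z| <= D.
  move=> /sub tb; rewrite /dF normrM ger0_norm// ler_wpM2l//.
  apply: (le_trans (normr_drift_le _ _ _ (flow_moment FY tb))).
  - exact: (flow_measurable FY).
  - exact: (flow_integrable FY).
  rewrite ler_wpM2l ?mulr_ge0 ?addr_ge0 ?(M0 t)// lerD2l ler_pXn2r ?nnegrE ?enorm_ge0 ?(ltW L0)//.
  exact: YL.
have cF z : {within `[0, b], continuous (F ^~ z)} by exact: (@flow_continuous _ _ _ _ FY z).
have derF (t : R) z : t \in `]0, b[ -> is_derive t 1 (F ^~ z) (dF t z).
  by move=> tb; exact: (@flow_derive _ _ _ _ FY t z tb).
have c2 := @continuous_integral _ _ _ P F dF b D _ mF FM cF derF dFD.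
have d2 := @is_derive_integral _ _ _ P F dF b D _ mF FM derF dFD.
have K0 : 0 <= 2 * C2 / (W - 1) by rewrite divr_ge0 ?mulr_ge0// ltW.
move=> t tb; have b0 : 0 \in `[0, b].
  by move: tb; rewrite !in_itv/= lexx/= => /andP[]; exact: le_trans.
apply: (barrier_le c2 d2 _ _ tb).
  rewrite (@le_trans _ _ (R0 ^+ 2))//.
    rewrite -(Rintegral_prob_cst P1 (R0 ^+ 2)); apply: le_Rintegral => //.
    - exact: (@bounded_integrable _ _ _ P _ (L ^+ 2) (mF 0 b0) (fun z => FM 0 z b0)).
    - exact: integrable_Rcst.
    move=> z _; rewrite ler_pXn2r ?nnegrE ?enorm_ge0 ?(flow_init FY)//.
    exact: le_trans (enorm_ge0 _) (flow_init FY z).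
  by rewrite -[leLHS]mulr1 ler_pM ?sqr_ge0// lerDl.
move=> u ub hu; have ub' := sub u ub.
have mY := flow_measurable FY ub'.
have iq : P.-integrable setT (EFin \o (fun z => enorm (Y u z) `^ (1 + a))).
  exact: (integrable_enorm_powR P1 mY (fun z => YL u z ub') (addr_ge0 ler01 a0)).
have iF : P.-integrable setT (EFin \o F u).
  exact: (@bounded_integrable _ _ _ P _ (L ^+ 2) (mF u ub') (fun z => FM u z ub')).
have idr : P.-integrable setT (EFin \o drift (Y u)).
  apply: (@bounded_integrable _ _ _ P _ D).
    apply: measurable_funB; apply: measurable_dotv => //; exact: measurable_kconv.
  by move=> z; apply: (le_trans _ (dFD u z ub)); rewrite /dF normrM ger0_norm// ler_peMl// ler1n.
rewrite /dF (RintegralZl 2 measurableT idr) pmulr_rle0//.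
have := averaged_drift_le ar W1 mY (fun z => YL u z ub').
set q := \int[P]_z enorm (Y u z) `^ (1 + a).
(* From [|Y| L^a <= |Y|^a L] and [L^a >= 1], one gets [|Y| <= L |Y|^a]; this is where [1 <= L]
   matters. *)
have hq : \int[P]_z F u z <= L * q.
  rewrite /q -(RintegralZl L measurableT iq); apply: le_Rintegral => //.
    exact: (integrableZl measurableT L iq).
  move=> z _; rewrite /F powR1D ?enorm_ge0// expr2 mulrCA ler_wpM2l ?enorm_ge0//.
  have := powR_exchange (enorm_ge0 (Y u z)) (YL u z ub') a1.
  rewrite [leRHS]mulrC; apply: le_trans.
  rewrite -[leLHS]mulr1 ler_wpM2l ?enorm_ge0//.
  by rewrite -(powRr0 L) ler_powR.
move=> h; apply: (le_trans h); rewrite pmulr_rle0; last by rewrite ltr_pwDl.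
rewrite subr_le0; have hL : 2 * C2 / (W - 1) * L < L * q.
  apply: lt_le_trans hq; apply: le_lt_trans hu.
  by rewrite ler_wpM2r ?(ltW L0)// lerDr sqr_ge0.
move: hL; rewrite mulrC ltr_pM2l// ltr_pdivrMr// => hL.
exact: arith.
Qed.

(** [barrier_le] for [|Y|^2] at level [(L / 2)^2]; the labels start below it since [R0 <= L / 2]. *)
Lemma half_barrier b M R0 Y L : admissible_flow b M R0 Y -> 0 <= L -> 2 * R0 <= L ->
  (forall (t : R) z, t \in `]0, b[ -> L / 2 <= enorm (Y t z) -> drift (Y t) z <= 0) ->
  forall (t : R) z, t \in `[0, b] -> enorm (Y t z) <= L / 2.
Proof.
move=> FY L0 RL dr t z tb.
have L20 : 0 <= L / 2 by rewrite divr_ge0.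
rewrite -(@ler_pXn2r _ 2) ?nnegrE ?enorm_ge0//.
apply: (barrier_le (@flow_continuous _ _ _ _ FY z)
  (fun u ub => @flow_derive _ _ _ _ FY u z ub) _ _ tb).
  rewrite ler_pXn2r ?nnegrE ?enorm_ge0// (le_trans (flow_init FY z))//.
  by rewrite ler_pdivlMr// mulrC.
move=> u ub; rewrite ltr_pXn2r ?nnegrE ?enorm_ge0// => hu.
by rewrite pmulr_rle0// dr// ltW.
Qed.

Lemma drift_le0 (Yt : T -> 'rV[R]_d) z : measurable_fun setT Yt ->
  P.-integrable setT (EFin \o (fun z => enorm (Yt z))) ->
  (1 + r) * (enorm (Yt z) `^ r * (enorm (Yt z) + \int[P]_z enorm (Yt z))) <=
  (1 + a) * (W * enorm (Yt z) `^ (1 + a) - 5 * C1 * enorm (Yt z) `^ a - 4 * Ca) ->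
  drift Yt z <= 0.
Proof.
move=> mY iY h; rewrite subr_le0 (le_trans _ (attraction _))// (le_trans _ h)//.
exact: le_trans (ler_norm _) (repulsion (Yt z) mY iY).
Qed.

(** The radius [L0] is such that [L / 2] exceeds 1, [R0] and the thresholds [A], [B] of
    [barrier_strict]. The first moment is at most [L], hence at most [2 X] wherever [X >= L / 2]. *)
Lemma halving_strict R0 : r < a -> 0 < W -> exists2 L0 : R, 0 < L0 &
  forall b M Y L, admissible_flow b M R0 Y -> L0 <= L ->
    (forall (t : R) z, t \in `[0, b] -> enorm (Y t z) <= L) ->
    forall (t : R) z, t \in `[0, b] -> enorm (Y t z) <= L / 2.
Proof.
move=> ra Wp; have /andP[r0 _] := r01.
pose A := 2 * (5 * C1 + 4 * Ca) / W; pose B := (6 / W) `^ (a - r)^-1.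
have A0 : 0 <= A by rewrite divr_ge0// mulr_ge0// addr_ge0// mulr_ge0.
have B0 : 0 <= B by exact: powR_ge0.
exists (2 + 2 * `|R0| + 2 * A + 2 * B).
  by have := normr_ge0 R0; lra.
move=> b M Y L FY LL YL; have Rn := ler_norm R0; have Rn0 := normr_ge0 R0.
have L0 : 0 <= L by lra.
apply: (half_barrier FY L0); first by lra.
move=> t z tb Lx; have tb' : t \in `[0, b].
  by move: tb; rewrite !in_itv/= => /andP[/ltW -> /ltW ->].
apply: drift_le0; [exact: (flow_measurable FY)|exact: (flow_integrable FY)|].
apply: barrier_strict => //; rewrite -/A -/B; [lra..|].
rewrite (@le_trans _ _ L)//; last by lra.
rewrite -(Rintegral_prob_cst P1 L); apply: le_Rintegral => //.
- exact: (flow_integrable FY).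
- exact: integrable_Rcst.
- by move=> u _; exact: YL.
Qed.

(** Integrating [v <= e L + v^2 / (e L)] and using the second moment bound [B L] gives a first
    moment at most [e L + B / e], hence at most [2 e L] once [B <= e^2 L]. The choice
    [e = (W - 1) / 8] makes this [(W - 1) / 2 * (L / 2)], as [barrier_equal] asks. *)
Lemma halving_equal R0 : a = r -> 1 < W -> exists2 L0 : R, 0 < L0 &
  forall b M Y L, admissible_flow b M R0 Y -> L0 <= L ->
    (forall (t : R) z, t \in `[0, b] -> enorm (Y t z) <= L) ->
    forall (t : R) z, t \in `[0, b] -> enorm (Y t z) <= L / 2.
Proof.
move=> ar W1; have /andP[a0 _] := a01; have om0 : 0 < W - 1 by rewrite subr_gt0.
pose A := 2 * (5 * C1 + 4 * Ca) / (W - 1); pose B := R0 ^+ 2 + 2 * C2 / (W - 1).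
pose e := (W - 1) / 8; have e0 : 0 < e by rewrite divr_gt0.
have A0 : 0 <= A by rewrite divr_ge0 ?(ltW om0)// mulr_ge0// addr_ge0// mulr_ge0.
have C20 : 0 <= C2.
  rewrite /C2 !addr_ge0 ?mulr_ge0 ?addr_ge0// divr_ge0 ?mulr_ge0// ltW//.
have B0 : 0 <= B by rewrite addr_ge0 ?sqr_ge0// divr_ge0 ?mulr_ge0// ltW.
have E0 : 0 <= B / e ^+ 2 by rewrite divr_ge0// sqr_ge0.
exists (2 + 2 * `|R0| + 2 * A + B / e ^+ 2).
  by have := normr_ge0 R0; lra.
move=> b M Y L FY LL YL; have Rn := ler_norm R0; have Rn0 := normr_ge0 R0.
have L1 : 1 <= L by lra.
have L0 : 0 < L by lra.
apply: (half_barrier FY (ltW L0)); first by lra.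
move=> t z tb Lx; have tb' : t \in `[0, b].
  by move: tb; rewrite !in_itv/= => /andP[/ltW -> /ltW ->].
have mY := flow_measurable FY tb'; have iY := flow_integrable FY tb'.
apply: drift_le0 => //; rewrite -[X in (1 + X) * (_ `^ X * _)]ar.
apply: barrier_equal => //; rewrite -/A; [lra..|].
have m2 := second_moment_le ar W1 FY L1 YL tb'; rewrite -/B in m2.
have eL0 : 0 < e * L by rewrite mulr_gt0.
have i2 : P.-integrable setT (EFin \o (fun u => enorm (Y t u) ^+ 2)).
  apply: (@bounded_integrable _ _ _ P _ (L ^+ 2)); first exact/measurable_funX/measurable_enorm.
  by move=> u; rewrite ger0_norm ?sqr_ge0// ler_pXn2r ?nnegrE ?enorm_ge0 ?(ltW L0)// YL.
have ic2 := integrableZl measurableT (e * L)^-1 i2.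
have BL : B <= e ^+ 2 * L.
  rewrite mulrC -ler_pdivrMr ?exprn_gt0//.
  by move: (B / e ^+ 2) E0 LL => u E0 LL; lra.
apply: (@le_trans _ _ (e * L + (e * L)^-1 * (B * L))).
  apply: (@le_trans _ _ (\int[P]_u (e * L + (e * L)^-1 * enorm (Y t u) ^+ 2))).
    apply: le_Rintegral => //.
      exact: (integrableD measurableT (integrable_Rcst P (e * L)) ic2).
    move=> u _; have := enorm_ge0 (Y t u); move: (enorm (Y t u)) => v v0.
    rewrite -(ler_pM2l eL0) mulrDr mulVKf ?gt_eqF//.
    by move: (e * L) eL0 => c c0; have := sqr_ge0 (v - c); nra.
  rewrite (RintegralD measurableT (integrable_Rcst P (e * L)) ic2).
  rewrite (Rintegral_prob_cst P1) (RintegralZl _ measurableT i2) lerD2l.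
  by rewrite ler_wpM2l// invr_ge0 ltW.
apply: (@le_trans _ _ (e * L + (e * L)^-1 * (e ^+ 2 * L * L))).
  by rewrite lerD2l ler_wpM2l ?invr_ge0 ?(ltW eL0)// ler_wpM2r// ltW.
have -> : (e * L)^-1 * (e ^+ 2 * L * L) = e * L by field; rewrite !gt_eqF.
apply: (@le_trans _ _ ((W - 1) / 2 * (L / 2))).
  by rewrite /e le_eqVlt; apply/orP; left; apply/eqP; field.
by rewrite ler_wpM2l// divr_ge0// ltW.
Qed.

Theorem admissible_flow_confined R0 :
  (r < a /\ 0 < W) \/ (a = r /\ 1 < W) ->
  exists Rstar, forall b M Y, admissible_flow b M R0 Y ->
    forall (t : R) z, t \in `[0, b] -> enorm (Y t z) <= Rstar.
Proof.
move=> conf; have [L0 L00 halve] : exists2 L0 : R, 0 < L0 &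
  forall b M Y L, admissible_flow b M R0 Y -> L0 <= L ->
    (forall (t : R) z, t \in `[0, b] -> enorm (Y t z) <= L) ->
    forall (t : R) z, t \in `[0, b] -> enorm (Y t z) <= L / 2.
  by case: conf => -[h hW]; [exact: halving_strict|exact: halving_equal].
exists L0 => b M Y FY t z tb.
have [L YL] := admissible_flow_bounded FY.
(* The supremum of the norms is itself an admissible bound [L]; were it above [L0], it would be at
   most half of itself. *)
pose A := [set x | exists (u : R) w, u \in `[0, b] /\ x = enorm (Y u w)].
have Atz : A (enorm (Y t z)) by exists t, z.
have supA : has_sup A.
  by split; [exists (enorm (Y t z))|exists L => x [u [w [ub ->]]]; exact: YL].
have Ysup (u : R) w : u \in `[0, b] -> enorm (Y u w) <= sup A.
  by move=> ub; apply: sup_upper_bound => //; exists u, w.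
apply: (le_trans (Ysup t z tb)); rewrite leNgt; apply/negP => L0s.
have : sup A <= sup A / 2.
  apply: ge_sup => [|x [u [w [ub ->]]]]; first by exists (enorm (Y t z)).
  exact: (halve b M Y _ FY (ltW L0s) Ysup).
by move: (sup A) L0s => s L0s; lra.
Qed.

End confinement.

(** * Lagrangian solutions *)

Section finite_weighted_measure.
Local Open Scope ereal_scope.
Context {dT} {T : measurableType dT} {R : realType} (mu : {measure set T -> \bar R}).
Variable f : T -> R.

(** A copy of [weighted] that also carries the proof of finiteness, from which the finite measure
    structure is inferred. *)
Definition fweighted (mf : measurable_fun setT f) (f0 : forall x, (0 <= f x)%R)
  (fin : \int[mu]_x (f x)%:E < +oo) : set T -> \bar R := weighted mu mf f0.

Hypotheses (mf : measurable_fun setT f) (f0 : forall x, (0 <= f x)%R).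
Hypothesis fin : \int[mu]_x (f x)%:E < +oo.

HB.instance Definition _ := Measure.copy (fweighted mf f0 fin) (weighted mu mf f0).

Let fweighted_fin : fin_num_fun (fweighted mf f0 fin).
Proof.
move=> A mA; rewrite ge0_fin_numE//; apply: le_lt_trans fin.
apply: ge0_subset_integral => //; first exact/measurable_EFinP.
by move=> x _; rewrite lee_fin.
Qed.

HB.instance Definition _ := Measure_isFinite.Build _ _ _ (fweighted mf f0 fin)
  fweighted_fin.

End finite_weighted_measure.

(** * Essential supports and compactness *)

Section essential_support.
Context {R : realType} {d : nat}.
Implicit Types f : 'rV[R]_d -> R.

Lemma ler_norm_enorm (x : 'rV[R]_d) : `|x| <= enorm x.
Proof.
rewrite /Num.Def.normr/= mx_normrE; apply: bigmax_le; first exact: enorm_ge0.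
by move=> [i j] _ /=; rewrite ord1; exact: ler_coord_enorm.
Qed.

Lemma compact_annulus (b c : R) : compact [set x : 'rV[R]_d | b <= enorm x <= c].
Proof.
apply: bounded_closed_compact.
  exists c; split; first exact: num_real.
  move=> M cM x /andP[_ xc]; apply: (le_trans (ler_norm_enorm x)).
  by rewrite (le_trans xc)// ltW.
rewrite (_ : mkset _ = @enorm R d @^-1` `[b, c]%classic).
  by apply: (continuous_closedP _).1; [exact: continuous_enorm|exact: itv_closed].
by apply/seteqP; split => x; rewrite /= in_itv.
Qed.

(* Covering compactness, applied to the filter of sets of full measure: around
   each point of a compact set avoiding [ess_supp f] the function vanishes
   a.e., hence it vanishes a.e. on the compact set. *)
Lemma ae0_compact f (K : set 'rV[R]_d) : compact K -> K `&` ess_supp f = set0 ->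
  {ae lebesgue_rV d, forall x, K x -> f x = 0}.
Proof.
move=> /compact_near_coveringP cK Kf.
have H : \forall y \near almost_everywhere (lebesgue_rV d),
    K `<=` (fun x => y = x -> f y = 0).
  apply: (cK _ _ (fun y x => y = x -> f y = 0)) => x Kx.
  have : ~ ess_supp f x by move=> fx; have : (K `&` ess_supp f) x by []; rewrite Kf.
  move=> /existsNP[U] /not_implyP[xU] /contrapT fU.
  exists (U, [set y | U y -> f y = 0]); first by split.
  by move=> [x' y] [/= Ux' h] yx'; apply: h; rewrite yx'.
by apply: filterS H => y Hy Ky; exact: Hy Ky erefl.
Qed.

(** The exterior of a ball is a countable union of compact annuli. The inner radius [b + 1] keeps
    them away from the support, which lies within radius [b]. *)
Lemma ess_supp_compact_ae f : compact (ess_supp f) ->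
  exists2 b : R, 0 <= b & {ae lebesgue_rV d, forall x, b < enorm x -> f x = 0}.
Proof.
move=> cf.
have /compact_bounded [M [Mr hM]] : compact (@enorm R d @` ess_supp f).
  by apply: continuous_compact => //; apply: continuous_subspaceT; exact: continuous_enorm.
pose b : R := `|M| + 1; have b0 : 0 <= b by rewrite addr_ge0.
have sb x : ess_supp f x -> enorm x <= b.
  move=> fx; rewrite -(ger0_norm (enorm_ge0 x)); apply: hM; last by exists x.
  by rewrite /b (le_lt_trans (ler_norm M))// ltrDl.
exists (b + 1); first by rewrite addr_ge0.
have H n : {ae lebesgue_rV d, forall x, b + 1 <= enorm x <= n%:R -> f x = 0}.
  have := @ae0_compact f _ (@compact_annulus (b + 1) n%:R); apply.
  apply/seteqP; split => // x [/= /andP[bx _] /sb]; apply/negP; rewrite -ltNge.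
  by rewrite (lt_le_trans _ bx)// ltrDl.
have /ae_foralln := H; apply: filterS => x hx bx.
apply: (hx (Num.trunc (enorm x)).+1); rewrite (ltW bx)/=.
exact/ltW/truncnS_gt.
Qed.

End essential_support.

(** * Change of variables along the flow *)

Section transport.
Context {R : realType} {d : nat}.
Variables (f : 'rV[R]_d -> R) (mf : measurable_fun setT f) (f0 : forall x, 0 <= f x).
Variables (dT : measure_display) (T : measurableType dT).
Variables (P : {measure set T -> \bar R}) (X : T -> 'rV[R]_d).
Hypotheses (mX : measurable_fun setT X)
  (fX : forall A, measurable A -> density f A = pushforward P X A).

Lemma ge0_integral_transported (g : 'rV[R]_d -> \bar R) :
  measurable_fun setT g -> (forall x, 0 <= g x)%E ->
  (\int[lebesgue_rV d]_y (g y * (f y)%:E) = \int[P]_z g (X z))%E.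
Proof.
move=> mg g0; rewrite -(ge0_integral_weighted _ mf f0 mg g0).
transitivity (\int[pushforward P X]_y g y)%E.
  by apply: eq_measure_integral => A mA _; exact: fX.
by rewrite ge0_integral_pushforward.
Qed.

Lemma Rintegral_transported (g : 'rV[R]_d -> R) : measurable_fun setT g ->
  \int[lebesgue_rV d]_y (g y * f y) = \int[P]_z g (X z).
Proof.
move=> mg; have mg' : measurable_fun setT (EFin \o g) by exact/measurable_EFinP.
rewrite /Rintegral; congr fine; rewrite [LHS]integralE [RHS]integralE.
congr (_ - _)%E.
  transitivity (\int[P]_z (EFin \o g)^\+ (X z))%E.
    rewrite -ge0_integral_transported//; last exact: measurable_funepos.
    by apply: eq_integral => x _; rewrite !funeposE EFinM maxeMl ?lee_fin// mul0e.
  by apply: eq_integral => z _; rewrite !funeposE.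
transitivity (\int[P]_z (EFin \o g)^\- (X z))%E.
  rewrite -ge0_integral_transported//; last exact: measurable_funeneg.
  by apply: eq_integral => x _; rewrite !funenegE EFinM -mulNe maxeMl ?lee_fin// mul0e.
by apply: eq_integral => z _; rewrite !funenegE.
Qed.

End transport.

Section japanese_bracket.
Context {R : realType} {d : nat}.
Implicit Types x : 'rV[R]_d.

Lemma japanese_ge1 x : 1 <= japanese x.
Proof. by rewrite -[leLHS]sqrtr1; apply: ler_wsqrtr; rewrite lerDl sqr_ge0. Qed.

Lemma enorm_le_japanese x : enorm x <= japanese x.
Proof.
by rewrite -(ger0_norm (enorm_ge0 x)) -sqrtr_sqr; apply: ler_wsqrtr; rewrite lerDr.
Qed.

Lemma measurable_japanese_powR (p : R) :
  measurable_fun setT (fun x => japanese x `^ p).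
Proof.
apply: (measurableT_comp (measurable_powR p)).
rewrite (_ : @japanese R d = (fun x => (1 + enorm x ^+ 2) `^ 2^-1)); last first.
  by apply/funext => x; rewrite powR12_sqrt// addr_ge0// sqr_ge0.
apply: (measurableT_comp (measurable_powR _)); apply: measurable_funD => //.
by apply: measurable_funX; exact: measurable_enorm.
Qed.

Lemma ler_japanese_powR p x : 1 <= p -> japanese x <= japanese x `^ p.
Proof. by move=> p1; apply: le1r_powR => //; exact: japanese_ge1. Qed.

End japanese_bracket.

Section weighted_integrability.
Context {R : realType} {d : nat}.
Variables (f : 'rV[R]_d -> R) (mf : measurable_fun setT f) (f0 : forall x, 0 <= f x).
Hypothesis fin : (\int[lebesgue_rV d]_x (f x)%:E < +oo)%E.

Lemma fweighted_integrable (g : 'rV[R]_d -> R) : measurable_fun setT g ->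
  (forall x, 0 <= g x) -> (\int[lebesgue_rV d]_x (g x * f x)%:E < +oo)%E ->
  (fweighted mf f0 fin).-integrable setT (EFin \o g).
Proof.
move=> mg g0 gf; apply/integrableP; split; first exact/measurable_EFinP.
rewrite (_ : integral _ _ _ = \int[lebesgue_rV d]_x (g x * f x)%:E)%E//.
transitivity (\int[weighted (lebesgue_rV d) mf f0]_x (g x)%:E)%E.
  by apply: eq_integral => x _; rewrite /= ger0_norm.
by rewrite ge0_integral_weighted//; exact/measurable_EFinP.
Qed.

Lemma convolution_fweighted s x :
  convolution (kernel_K s) f x = kconv (fweighted mf f0 fin) id s x.
Proof.
apply/rowP => i; rewrite !mxE -(@Rintegral_weighted _ _ _ _ _ mf f0)//.
by apply/measurable_fun_coord/measurable_kernel/measurable_rVB.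
Qed.

End weighted_integrability.

Section measurability.
Context {R : realType} {d : nat}.

Lemma measurable_enorm_gt (b : R) : measurable [set x : 'rV[R]_d | b < enorm x].
Proof.
have -> : [set x : 'rV[R]_d | b < enorm x] = (@enorm R d) @^-1` `]b, +oo[.
  by apply/seteqP; split => x; rewrite /= in_itv/= andbT.
by rewrite -[X in measurable X]setTI; exact: (measurable_enorm (f := id)).
Qed.

Lemma measurable_section (D : set R) (phi : R -> 'rV[R]_d -> R) (t : R) :
  measurable D -> D t ->
  measurable_fun (D `*` [set: 'rV[R]_d])
    (fun z : measurableTypeR R * 'rV[R]_d => phi z.1 z.2) ->
  measurable_fun setT (phi t).
Proof.
move=> mD Dt mphi.
have : measurable_fun setT ((fun z : measurableTypeR R * 'rV[R]_d => phi z.1 z.2) \o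
    (fun x => (t : measurableTypeR R, x))).
  apply: (measurable_comp _ _ mphi).
  - by apply: measurableX.
  - by move=> _ [x _ <-].
  - exact: measurable_pair1.
by [].
Qed.

End measurability.

Section lagrangian_flow.
Context {R : realType} {d : nat}.
Variables (a r p : R) (omega phi0 : 'rV[R]_d -> R) (phi : R -> 'rV[R]_d -> R).
Local Notation mu := (lebesgue_rV d).
Hypotheses (p1 : 1 < p).
Hypotheses (momega : measurable_fun setT omega) (mphi0 : measurable_fun setT phi0).
Hypotheses (omega_ge0 : forall x, 0 <= omega x) (phi0_ge0 : forall x, 0 <= phi0 x).
Hypotheses (omega_fin : (\int[mu]_x (omega x)%:E < +oo)%E)
  (phi0_fin : (\int[mu]_x (phi0 x)%:E < +oo)%E).

Let P := fweighted mphi0 phi0_ge0 phi0_fin.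
Let nu := fweighted momega omega_ge0 omega_fin.

(* Modifying the flow on a null set of labels, where it is set to [0], makes
   all its properties hold for every label. *)
Lemma lagrangian_admissible (R0 T : R) : 0 <= R0 -> 0 < T ->
  {ae mu, forall x, R0 < enorm x -> phi0 x = 0} ->
  lagrangian_solution a r omega phi0 T phi -> locally_bounded p T phi ->
  exists M Y, admissible_flow P nu id a r T M R0 Y /\
    forall t : R, t \in `[0, T] -> forall A, measurable A ->
      density (phi t) A = pushforward P (Y t) A.
Proof.
move=> R00 T0 suppR0 [mphi phi_ge0 _ _ [X [flowX transX]]] [M hM].
have [B1 [mB1 B10 hB1]] := flowX.
pose A := [set x : 'rV[R]_d | R0 < enorm x].
have mA : measurable A by exact: measurable_enorm_gt.
have PA0 : P A = 0%E.
  have : (\int[mu]_(x in A) `|(phi0 x)%:E| = 0)%E.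
    apply/ae_eq_integral_abs => //; first exact/measurable_EFinP/measurable_funTS.
    by apply: filterS suppR0 => x hx Ax; rewrite /= hx.
  move=> <-; apply: eq_integral => x _.
  by rewrite gee0_abs// lee_fin.
(* [B1] contains the labels at which the flow equation may fail, [A] those outside the initial ball;
   both are null for [P]. *)
pose N := B1 `|` A.
have mN : measurable N by exact: measurableU.
have PN0 : P N = 0%E.
  by apply/(negligibleP P mN)/negligibleU; exact/negligibleP.
pose Y t z := (\1_(~` N) z : R) *: X t z.
have YX t z : ~ N z -> Y t z = X t z.
  by move=> Nz; rewrite /Y indicE mem_set// scale1r.
have Y0 t z : N z -> Y t z = 0.
  by move=> Nz; rewrite /Y indicE memNset ?scale0r//; exact.
have goodX z : ~ N z -> [/\ X 0 z = z, {within `[0, T], continuous (X ^~ z)}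
      & forall t, t \in `]0, T[ ->
          is_derive t 1 (X ^~ z) (velocity a r omega (phi t) (X t z))].
  by move=> Nz; apply: contrapT => h; apply: Nz; left; exact: hB1.
have sub (t : R) : t \in `]0, T[ -> t \in `[0, T].
  by rewrite !in_itv/= => /andP[/ltW -> /ltW ->].
have mX (t : R) : t \in `[0, T] -> measurable_fun setT (X t) by move=> /transX[].
have mY (t : R) : t \in `[0, T] -> measurable_fun setT (Y t).
  by move=> tT; apply: measurable_rVZ; [apply: measurable_indic; exact: measurableC|exact: mX].
(* Preimages under [X t] and [Y t] agree outside the null set [N], so the two flows have the same
   law. *)
have dY (t : R) : t \in `[0, T] -> forall B, measurable B ->
    density (phi t) B = pushforward P (Y t) B.
  move=> tT B mB; have [_ /(_ B mB) ->] := transX t tT.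
  have mXB : measurable (X t @^-1` B) by rewrite -[X in measurable X]setTI; exact: mX.
  have mYB : measurable (Y t @^-1` B) by rewrite -[X in measurable X]setTI; exact: mY.
  have PN D E : measurable D -> measurable E -> D `\` N `<=` E -> (P D <= P E)%E.
    move=> mD mE DE; apply: (@le_trans _ _ (P (E `|` N))).
      apply: le_measure; rewrite ?inE//; first exact: measurableU.
      by move=> z Dz; have [Nz|Nz] := pselect (N z); [right|left; exact: DE].
    have <- : (P E + P N = P E)%E by rewrite PN0 adde0.
    exact: measureU2.
  apply/eqP; rewrite eq_le; apply/andP; split; apply: PN => // z [+ Nz].
    by rewrite /preimage/= YX.
  by rewrite /preimage/= YX.
have mphit (t : R) : t \in `[0, T] -> measurable_fun setT (phi t).
  by move=> tT; apply: (measurable_section _ _ mphi).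
exists M, Y; split => //.
(* The first moment is carried back to a space integral and bounded by the [p]-moment, as
   [|x| <= <x> <= <x>^p]. *)
have Yint (t : R) : t \in `[0, T] ->
    (\int[P]_z (enorm (Y t z))%:E <= M%:E)%E.
  move=> tT; have [_] := hM t tT; apply: le_trans.
  have me : measurable_fun setT (fun y : 'rV[R]_d => (enorm y)%:E).
    by apply/measurable_EFinP; exact: measurable_enorm.
  rewrite -(ge0_integral_transported (mphit t tT) (fun x => phi_ge0 t x tT) (mY t tT) (dY t tT) me); last first.
    by move=> x; rewrite lee_fin enorm_ge0.
  apply: ge0_le_integral => //.
  - by move=> x _; rewrite -EFinM lee_fin mulr_ge0 ?enorm_ge0 ?phi_ge0.
  - by apply: emeasurable_funM => //; apply/measurable_EFinP; exact: mphit.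
  - by apply/measurable_EFinP/measurable_funM; [exact: measurable_japanese_powR|exact: mphit].
  - move=> x _; rewrite -EFinM lee_fin ler_wpM2r ?phi_ge0//.
    rewrite (le_trans (enorm_le_japanese x))// ler_japanese_powR//; exact: ltW.
have iY (t : R) : t \in `[0, T] -> P.-integrable setT (EFin \o (fun z => enorm (Y t z))).
  move=> tT; apply/integrableP; split.
    by apply/measurable_EFinP/measurable_enorm; exact: mY.
  apply: (@le_lt_trans _ _ M%:E); last exact: ltry.
  apply: le_trans (Yint t tT); rewrite le_eqVlt; apply/orP; left; apply/eqP.
  by apply: eq_integral => z _ /=; rewrite ger0_norm ?enorm_ge0.
split => //.
- move=> z; have [Nz|Nz] := pselect (N z); first by rewrite Y0// enorm0.
  have [X0 _ _] := goodX z Nz; rewrite YX// X0 leNgt; apply/negP => h.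
  by apply: Nz; right.
- move=> z; have [Nz|Nz] := pselect (N z).
    rewrite (_ : (fun t => _) = cst 0); last first.
      by apply/funext => t; rewrite Y0// enorm0 expr0n.
    by apply: continuous_subspaceT => x; exact: cvg_cst.
  have [_ cX _] := goodX z Nz.
  rewrite (_ : (fun t => _) = (fun x => enorm x ^+ 2) \o (X ^~ z)); last first.
    by apply/funext => t /=; rewrite YX.
  have cn : continuous (fun x : 'rV[R]_d => enorm x ^+ 2).
    move=> x; apply: (@continuous_comp _ _ _ _ (fun u : R => u ^+ 2)).
      exact: continuous_enorm.
    exact: exprn_continuous.
  by move=> u; exact: (continuous_comp (cX u) (cn _)).
- move=> t z tT; have [Nz|Nz] := pselect (N z).
    rewrite (_ : (fun t => _) = cst 0); last first.
      by apply/funext => u; rewrite Y0// enorm0 expr0n.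
    (* At a label of [N] the modified flow rests at 0, where the drift is a scalar product with
       0. *)
    by rewrite /drift Y0// !dot0v subr0 mulr0; exact: is_derive_cst.
  have [_ _ /(_ t tT) dX] := goodX z Nz.
  rewrite (_ : (fun t => _) = (fun u => enorm (X u z) ^+ 2)); last first.
    by apply/funext => u /=; rewrite YX.
  have tT' := sub t tT.
  suff -> : 2 * drift P nu id a r (Y t) z =
      2 * dotv (X t z) (velocity a r omega (phi t) (X t z)).
    exact: is_derive_enorm_sqr.
  (* The convolution with [phi t] becomes an average over labels by the change of variables along
     [Y t]. *)
  rewrite /drift YX// /velocity dotvDr dotvNr [in RHS]addrC; congr (2 * (_ - _)).
    congr dotv; apply/rowP => i; rewrite !mxE.
    apply/esym/(Rintegral_transported (mphit t tT') (fun x => phi_ge0 t x tT') (mY t tT') (dY t tT')).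
    by apply/measurable_fun_coord/measurable_kernel/measurable_rVB.
  by rewrite (convolution_fweighted momega omega_ge0 omega_fin).
- move=> t tT; rewrite -lee_fin /Rintegral fineK; first exact: Yint.
  exact: integrable_fin_num (iY t tT).
Qed.

End lagrangian_flow.

Section support_in_ball.
Context {R : realType} {d : nat}.

(** The open set [|y| > b] carries no mass, so it misses the support. The support may touch the
    sphere of radius [b], whereas [eball] is open: hence [b + 1]. *)
Lemma ess_supp_eball (f : 'rV[R]_d -> R) (b : R) : measurable_fun setT f ->
  (forall x, 0 <= f x) -> density f [set x | b < enorm x] = 0%E ->
  ess_supp f `<=` eball (b + 1).
Proof.
move=> mf f0 fb x fx; rewrite /eball/= ltNge; apply/negP => bx.
pose U := [set y : 'rV[R]_d | b < enorm y].
have mU : measurable U by exact: measurable_enorm_gt.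
apply: (fx U).
  apply: open_nbhs_nbhs; split; last by rewrite /U/= (lt_le_trans _ bx)// ltrDl.
  have -> : U = (@enorm R d) @^-1` `]b, +oo[.
    by apply/seteqP; split => y; rewrite /U/= in_itv/= andbT.
  by apply: (continuousP _).1; [exact: continuous_enorm|exact: interval_open].
have : ae_eq (lebesgue_rV d) U (EFin \o f) (cst 0%E).
  apply/ae_eq_integral_abs => //; first exact/measurable_EFinP/measurable_funTS.
  by rewrite -fb; apply: eq_integral => y _; rewrite /= ger0_norm.
by apply: filterS => y hy Uy; have [] := hy Uy.
Qed.

End support_in_ball.

Theorem theorem5p6 (R : realType) (d : nat) (a r p : R)
  (omega phi0 : 'rV[R]_d -> R) (phi : R -> 'rV[R]_d -> R)
  (hd : (1 <= d)%N) (ha : a \in `[0, 1]) (hr : r \in `[0, 1]) (hp : 1 < p)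
  (omega_ge0 : forall x, 0 <= omega x) (phi0_ge0 : forall x, 0 <= phi0 x)
  (omega_L1 : omega \in Lfun (lebesgue_rV d) 1%E)
  (omega_Loo : omega \in Lfun (lebesgue_rV d) +oo%E)
  (phi0_L1 : phi0 \in Lfun (lebesgue_rV d) 1%E)
  (phi0_Loo : phi0 \in Lfun (lebesgue_rV d) +oo%E)
  (phi0_mass : (\int[lebesgue_rV d]_x (phi0 x)%:E = 1)%E)
  (moment : (\int[lebesgue_rV d]_x
     (japanese x `^ p * (omega x + phi0 x))%:E < +oo)%E)
  (phi_sol : global_solution a r omega phi0 p phi)
  (phi0_supp : compact (ess_supp phi0))
  (omega_moment : (\int[lebesgue_rV d]_x
     (enorm x `^ (1 + a) * omega x)%:E < +oo)%E)
  (confining :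
     (r < a /\ (0 < \int[lebesgue_rV d]_x (omega x)%:E)%E) \/
     (a = r /\ (1 < \int[lebesgue_rV d]_x (omega x)%:E)%E)) :
  exists Rstar : R, forall t, 0 <= t -> ess_supp (phi t) `<=` eball Rstar.
Proof.
have momega : measurable_fun setT omega := set_mem (sub_Lfun_mfun omega_L1).
have mphi0 : measurable_fun setT phi0 := set_mem (sub_Lfun_mfun phi0_L1).
have a01 : 0 <= a <= 1 by move: ha; rewrite in_itv.
have r01 : 0 <= r <= 1 by move: hr; rewrite in_itv.
(* The [p]-moment hypothesis yields the finite mass and the finite first moment of [omega]. *)
have dominated (g : 'rV[R]_d -> R) : measurable_fun setT g -> (forall x, 0 <= g x) ->
    (forall x, g x <= japanese x) ->
    (\int[lebesgue_rV d]_x (g x * omega x)%:E < +oo)%E.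
  move=> mg g0 gj; apply: le_lt_trans moment; apply: ge0_le_integral => //.
  - by move=> x _; rewrite lee_fin mulr_ge0.
  - by apply/measurable_EFinP/measurable_funM.
  - apply/measurable_EFinP/measurable_funM; first exact: measurable_japanese_powR.
    exact: measurable_funD.
  - move=> x _; rewrite lee_fin ler_pM//; last by rewrite lerDl.
    by rewrite (le_trans (gj x))// ler_japanese_powR// ltW.
have omega_fin : (\int[lebesgue_rV d]_x (omega x)%:E < +oo)%E.
  have := @dominated (cst 1) (measurable_cst _) (fun=> ler01) japanese_ge1.
  by under eq_integral do rewrite mul1r.
have phi0_fin : (\int[lebesgue_rV d]_x (phi0 x)%:E < +oo)%E by rewrite phi0_mass ltry.
pose P := fweighted mphi0 phi0_ge0 phi0_fin.
pose nu := fweighted momega omega_ge0 omega_fin.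
have P1 : P setT = 1%E by exact: phi0_mass.
have id_meas : measurable_fun [set: 'rV[R]_d] id by exact: measurable_id.
have iZ : nu.-integrable setT (EFin \o (fun z => enorm (id z))).
  apply: fweighted_integrable; [exact: measurable_enorm|exact: enorm_ge0|].
  apply: dominated; [exact: measurable_enorm|exact: enorm_ge0|exact: enorm_le_japanese].
have iZa : nu.-integrable setT (EFin \o (fun z => enorm (id z) `^ (1 + a))).
  apply: fweighted_integrable => //; first exact: measurable_enorm_powR.
  by move=> x; exact: powR_ge0.
have conf : (r < a /\ 0 < fine (nu setT)) \/ (a = r /\ 1 < fine (nu setT)).
  have omegaE : (\int[lebesgue_rV d]_x (omega x)%:E = (fine (nu setT))%:E)%E.
    by rewrite fineK//; exact: fin_num_measure.
  by case: confining => -[h]; rewrite omegaE lte_fin => hW; [left|right].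
have [R0 R00 suppR0] := ess_supp_compact_ae phi0_supp.
have [Rs hRs] := admissible_flow_confined P1 a01 r01 id_meas iZ iZa R0 conf.
exists (Rs + 1) => t t0.
(* The horizon [t + 1] is positive even for [t = 0]; [Rs] was fixed before it. *)
have T0 : 0 < t + 1 by rewrite ltr_wpDl.
have tT : t \in `[0, t + 1].
  by rewrite in_itv/=; apply/andP; split => //; rewrite lerDl ler01.
have [sol bnd] := phi_sol _ T0.
have [M [Y [FY phiY]]] := lagrangian_admissible hp momega mphi0 omega_ge0 phi0_ge0
  omega_fin phi0_fin R00 T0 suppR0 sol bnd.
have [mphi phi_ge0 _ _ _] := sol.
apply: ess_supp_eball.
- by apply: (measurable_section _ _ mphi).
- by move=> x; exact: phi_ge0.
- rewrite (phiY t tT).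
    (* No label is ever beyond radius [Rs], so the preimage of the exterior is empty. *)
    rewrite /pushforward (_ : _ @^-1` _ = set0) ?measure0//.
    apply/seteqP; split => // z /=; apply/negP; rewrite -leNgt.
    exact: hRs FY t z tT.
  exact: measurable_enorm_gt.
Qed.
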